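(* Suppose that the initial data $\varrho_{0,h}\in Q_h(\Omega_h)$, $\mathbf m_{0,h}\in Q_h(\Omega_h;\mathbb R^N)$, $E_{0,h}\in Q_h(\Omega_h)$ satisfy, for some constant $\underline\varrho$, $$\varrho_{0,h}\ge \underline\varrho>0,\qquad E_{0,h}-\frac12\frac{|\mathbf m_{0,h}|^2}{\varrho_{0,h}}>0 .$$ Then the semi-discrete finite volume scheme (C), (M), (E) described in the context, with initial state $[\varrho_{0,h},\mathbf m_{0,h},E_{0,h}]$, admits a unique global-in-time solution $[\varrho_h,\mathbf m_h,E_h]$, and $$\varrho_h(t)>0,\qquad E_h(t)-\frac12\frac{|\mathbf m_h(t)|^2}{\varrho_h(t)}>0\qquad\text{for any } t\ge 0 .$$ Moreover, the following renormalized entropy balance holds: for every non-decreasing, concave, twice continuously differentiable function $\chi:\mathbb R\to\mathbb R$ that is bounded from above, and every $\Phi\in Q_h(\Omega_h)$, with $b(\varrho)=\varrho\log\varrho$, \begin{align*} \frac{d}{dt}&\int_{\Omega_h}\varrho_h\chi(s_h)\Phi\,dx-\sum_{\sigma\in\Sigma_{int}}\int_\sigma Up[\varrho_h\chi(s_h),\mathbf u_h]\,[[\Phi]]\,dS_h\\ &=h^{\alpha-1}\sum_{\sigma\in\Sigma_{int}}\int_\sigma[[\mathbf u_h]]^2\,\overline{\Big(\tfrac{\chi'(s_h)\Phi}{\vartheta_h}\Big)}\,dS_h+\frac12\sum_{\sigma\in\Sigma_{int}}\int_\sigma\Big(\tfrac{\chi'(s_h)\Phi}{\vartheta_h}\Big)^{\rm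 down}\varrho_h^{\rm up}\,|\overline{\mathbf u_h}\cdot\mathbf n|\,[[\mathbf u_h]]^2\,dS_h\\ &\quad+\sum_{\sigma\in\Sigma_{int}}\int_\sigma\mu_h\,\overline{\varrho_h}\,[[\mathbf u_h]]^2\,\overline{\Big(\tfrac{\chi'(s_h)\Phi}{\vartheta_h}\Big)}\,dS_h\\ &\quad+\sum_{\sigma\in\Sigma_{int}}\int_\sigma(\chi'(s_h)\Phi)^{\rm down}\Big(\widetilde{[[b(\varrho_h)]]}-b'(\varrho_h^{\rm down})\widetilde{[[\varrho_h]]}\Big)|\overline{\mathbf u_h}\cdot\mathbf n|\,dS_h\\ &\quad-c_v\sum_{\sigma\in\Sigma_{int}}\int_\sigma(\chi'(s_h)\Phi)^{\rm down}\varrho_h^{\rm up}\Big(\widetilde{[[\log\vartheta_h]]}-\tfrac1{\vartheta_h^{\rm down}}\widetilde{[[\vartheta_h]]}\Big)|\overline{\mathbf u_h}\cdot\mathbf n|\,dS_h\\ &\quad-\sum_{\sigma\in\Sigma_{int}}\int_\sigma\Phi^{\rm down}\varrho_h^{\rm up}\Big(\widetilde{[[\chi(s_h)]]}-\chi'(s_h^{\rm down})\widetilde{[[s_h]]}\Big)|\overline{\mathbf u_h}\cdot\mathbf n|\,dS_h\\ &\quad-\sum_{\sigma\in\Sigma_{int}}\int_\sigma\mu_h\,[[\Phi\,\nabla_\varrho(\varrho_h\chi(s_h))]]\,[[\varrho_h]]\,dS_h-\sum_{\sigma\in\Sigma_{int}}\int_\sigma\mu_h\,[[\Phi\,\nabla_p(\varrho_h\chi(s_h))]]\,[[p_h]]\,dS_h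 . \end{align*} Here $\nabla_\varrho(\varrho_h\chi(s_h))$ and $\nabla_p(\varrho_h\chi(s_h))$ denote the partial derivatives of $(\varrho,p)\mapsto\varrho\,\chi\big(\tfrac1{\gamma-1}\log(p/\varrho^\gamma)\big)$ evaluated at $(\varrho_h,p_h)$.
   Context: Mesh. $\Omega_h\subset\mathbb R^N$, $N\in\{1,2,3\}$, is a polyhedral domain, $\overline{\Omega}_h=\bigcup_{K\in\mathcal T_h}K$ with $\mathcal T_h$ a finite regular mesh of compact elements (two elements share at most a common face, edge or vertex), $|K|\approx h^N$, $|\sigma|\approx h^{N-1}$ for elements $K$ and faces $\sigma$. $\Sigma_{int}$ is the set of interior faces; each face carries a fixed unit normal $\mathbf n$. $Q_h(\Omega_h)$ (resp. $Q_h(\Omega_h;\mathbb R^N)$) is the set of scalar (resp. vector) functions constant on each element. Traces. On $\sigma\in\Sigma_{int}$: $v^{\rm out}(x)=\lim_{\delta\to0+}v(x+\delta\mathbf n)$, $v^{\rm in}(x)=\lim_{\delta\to0+}v(x-\delta\mathbf n)$, $\overline v=\frac12(v^{\rm in}+v^{\rm out})$, $[[v]]=v^{\rm out}-v^{\rm in}$; for vectors $[[\mathbf v]]^2=|[[\mathbf v]]|^2$. For a velocity $\mathbf u$: $Up[r,\mathbf u]=\overline r\,\overline{\mathbf u}\cdot\mathbf n-\frac12|\overline{\mathbf u}\cdot\mathbf n|[[r]]$ (componentwise for vector $r$). $r^{\rm up}=r^{\rm in}$, $r^{\rm down}=r^{\rm out}$ if $\overline{\mathbf u_h}\cdot\mathbf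 n\ge0$, and $r^{\rm up}=r^{\rm out}$, $r^{\rm down}=r^{\rm in}$ if $\overline{\mathbf u_h}\cdot\mathbf n<0$; $\widetilde{[[r]]}=r^{\rm up}-r^{\rm down}$. Parameters. $\gamma>1$, $c_v=1/(\gamma-1)$, $\alpha$ a fixed real parameter; $\mu_h\ge0$ is a face-wise numerical viscosity, typically $\mu_h=hM(h,\overline{\varrho_h},\overline{\mathbf m_h},\overline{E_h})$ with $M$ continuous, regular enough for standard ODE theory to give, for each admissible initial state ($\varrho>0$ and $E-\frac12|\mathbf m|^2/\varrho>0$ on every element), a unique solution of the scheme on a maximal time interval $[0,T_{\max})$ on which it remains admissible. Numerical flux: $F_h(r,\mathbf u)=Up[r,\mathbf u]-\mu_h[[r]]$ (componentwise $\mathbf F_h$ for vectors). Scheme (semi-discrete; unknowns $\varrho_h,E_h\in Q_h(\Omega_h)$, $\mathbf m_h\in Q_h(\Omega_h;\mathbb R^N)$ are functions of time $t$), with $\mathbf u_h=\mathbf m_h/\varrho_h$, $p_h=(\gamma-1)\big(E_h-\frac12|\mathbf m_h|^2/\varrho_h\big)$, temperature $\vartheta_h=p_h/\varrho_h$, entropy $s_h=\log(\vartheta_h^{c_v}/\varrho_h)=\frac1{\gamma-1}\log(p_h/\varrho_h^\gamma)$: (C) $\int_{\Omega_h}\frac{d}{dt}\varrho_h\,\Phi\,dx-\sum_{\sigma\in\Sigma_{int}}\int_\sigma F_h(\varrho_h,\mathbf u_h)[[\Phi]]\,dS_h=0$ for all $\Phi\in Q_h(\Omega_h)$; (M) $\int_{\Omega_h}\frac{d}{dt}\mathbf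 m_h\cdot\boldsymbol\Phi\,dx-\sum_{\sigma\in\Sigma_{int}}\int_\sigma\mathbf F_h(\mathbf m_h,\mathbf u_h)\cdot[[\boldsymbol\Phi]]\,dS_h-\sum_{\sigma\in\Sigma_{int}}\int_\sigma\overline{p_h}\,\mathbf n\cdot[[\boldsymbol\Phi]]\,dS_h=-h^{\alpha-1}\sum_{\sigma\in\Sigma_{int}}\int_\sigma[[\mathbf u_h]]\cdot[[\boldsymbol\Phi]]\,dS_h$ for all $\boldsymbol\Phi\in Q_h(\Omega_h;\mathbb R^N)$; (E) $\int_{\Omega_h}\frac{d}{dt}E_h\,\Phi\,dx-\sum_{\sigma\in\Sigma_{int}}\int_\sigma F_h(E_h,\mathbf u_h)[[\Phi]]\,dS_h-\sum_{\sigma\in\Sigma_{int}}\int_\sigma\overline{p_h}\,[[\Phi\mathbf u_h]]\cdot\mathbf n\,dS_h+\sum_{\sigma\in\Sigma_{int}}\int_\sigma\overline{p_h\Phi}\,[[\mathbf u_h]]\cdot\mathbf n\,dS_h=-h^{\alpha-1}\sum_{\sigma\in\Sigma_{int}}\int_\sigma[[\mathbf u_h]]\cdot\overline{\mathbf u_h}\,[[\Phi]]\,dS_h$ for all $\Phi\in Q_h(\Omega_h)$. Boundary conditions: no-flux, $\mathbf u_h\cdot\mathbf n=0$ on every face in $\partial\Omega_h$, with $\varrho_h,p_h$ extrapolated ($\partial\varrho_h/\partial\mathbf n=\partial p_h/\partial\mathbf n=0$).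
   Formalization: The entropy balance as displayed fails if μ_h>0; the right side gets the extra term −¼ΣS∫μ_h[[ρ_h]][[u_h]]²[[χ'(s_h)Φ/θ_h]]. The no-flux condition is read as a wall pressure: (M) gets +Σ∫p_h n·Φ over boundary faces on its left side. *)

(* Defs.v *)
From HB Require Import structures.
From mathcomp Require Import all_boot all_order all_algebra.
From mathcomp Require Import all_classical all_reals all_analysis.
Import Order.TTheory GRing.Theory Num.Theory.
Import numFieldNormedType.Exports.

Set Implicit Arguments.
Unset Strict Implicit.
Unset Printing Implicit Defensive.

Local Open Scope classical_set_scope.
Local Open Scope ring_scope.

(* The norm that the library puts on 'rV[R]_N is the sup norm; the Euclidean
   structure is given here. *)
Definition dot (R : realType) (N : nat) (u v : 'rV[R]_N) : R :=
  \sum_(i < N) u ord0 i * v ord0 i.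

Definition sqnorm (R : realType) (N : nat) (u : 'rV[R]_N) : R := dot u u.

(* d-dimensional Hausdorff measure on R^N, d <= 3, normalised by the volume of
   the d-ball of diameter 1.  It is Lebesgue measure for d = N, surface area for
   d = N - 1, and the counting measure for d = 0. *)
Section Hausdorff.
Variables (R : realType) (N : nat).
Local Open Scope ereal_scope.

Definition diam (A : set 'rV[R]_N) : \bar R :=
  ereal_sup [set z | exists x y, [/\ A x, A y &
                     z = (Num.sqrt (sqnorm (x - y)))%:E]].

Definition unit_diam_ball (d : nat) : R :=
  match d with 0 | 1 => 1 | 2 => pi / 4 | _ => pi / 6 end%R.

(* The case distinction makes the empty set free also when d = 0. *)
Definition hausdorff_cost (d : nat) (A : set 'rV[R]_N) : \bar R :=
  if `[< A = set0 >] then 0 else (unit_diam_ball d * fine (diam A) ^+ d)%:E.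

Definition hausdorff_content (d : nat) (delta : R) (A : set 'rV[R]_N) : \bar R :=
  ereal_inf [set z | exists C : nat -> set 'rV[R]_N,
    [/\ forall k, diam (C k) <= delta%:E, A `<=` \bigcup_k C k &
        z = \sum_(0 <= k <oo) hausdorff_cost d (C k)]].

Definition hausdorff (d : nat) (A : set 'rV[R]_N) : \bar R :=
  ereal_sup [set hausdorff_content d delta A | delta in [set x : R | (0 < x)%R]].

End Hausdorff.

(* Raw data of a mesh.  The unit normal of an interior face points from the
   element [inK] to the element [outK]; the normal of a face contained in the
   boundary points out of the element [ownK]. *)
Record mesh_data (R : realType) (N : nat) := MeshData {
  mesh_size : R;
  elem : finType;
  iface : finType;
  bface : finType;
  cell : elem -> set 'rV[R]_N;
  face_set : (iface + bface)%type -> set 'rV[R]_N;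
  face_normal : (iface + bface)%type -> 'rV[R]_N;
  inK : iface -> elem;
  outK : iface -> elem;
  ownK : bface -> elem }.

Section Mesh.
Variables (R : realType) (N : nat) (T : mesh_data R N).

Definition face : finType := (iface T + bface T)%type.

Definition covered : set 'rV[R]_N := \bigcup_(K in [set: elem T]) cell K.

Definition Omega : set 'rV[R]_N := interior covered.

Definition faces_of (K : elem T) : set face :=
  [set f | match f with inl s => inK s = K \/ outK s = K | inr b => ownK b = K end].

(* Points of a face away from its relative boundary. *)
Definition face_core (f : face) : set 'rV[R]_N :=
  face_set f `\` \bigcup_(g in [set g | g <> f]) face_set g.

Definition vol (K : elem T) : R := fine (hausdorff N (cell K)).

Definition area (f : face) : R := fine (hausdorff N.-1 (face_set f)).

Record regular_mesh : Prop := RegularMesh {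
  mesh_size_gt0 : 0 < mesh_size T;
  Omega_nonempty : Omega !=set0;
  Omega_connected : connected Omega;
  cell_compact : forall K : elem T, compact (cell K);
  cell_regular : forall K : elem T, cell K = closure (interior (cell K));
  cell_disjoint : forall K L : elem T, K <> L ->
    interior (cell K) `&` interior (cell L) = set0;
  cell_boundary : forall K : elem T,
    cell K `\` interior (cell K) = \bigcup_(f in faces_of K) face_set f;
  iface_cells : forall s : iface T, inK s <> outK s;
  (* two elements share at most a common face, edge or vertex, the last two
     being intersections of faces *)
  iface_common : forall s : iface T,
    face_set (inl s) = cell (inK s) `&` cell (outK s);
  cell_conforming : forall K L : elem T, K <> L ->
    cell K `&` cell L = set0 \/
    exists A B : set face,
      [/\ A !=set0 /\ B !=set0, A `<=` faces_of K, B `<=` faces_of L,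
          cell K `&` cell L = \bigcap_(f in A) face_set f &
          cell K `&` cell L = \bigcap_(f in B) face_set f];
  bface_boundary : forall b : bface T, face_set (inr b) `&` Omega = set0;
  normal_unit : forall f : face, sqnorm (face_normal f) = 1;
  face_flat : forall (f : face) (x y : 'rV[R]_N),
    face_set f x -> face_set f y -> dot (x - y) (face_normal f) = 0;
  (* these two identify the one-sided limits of an elementwise constant
     function on a face with its values in the adjacent elements *)
  inormal_orientation : forall (s : iface T) (x : 'rV[R]_N),
    face_core (inl s) x -> \forall d \near 0^'+,
      interior (cell (inK s)) (x - d *: face_normal (inl s)) /\
      interior (cell (outK s)) (x + d *: face_normal (inl s));
  bnormal_orientation : forall (b : bface T) (x : 'rV[R]_N),
    face_core (inr b) x -> \forall d \near 0^'+,
      interior (cell (ownK b)) (x - d *: face_normal (inr b)) /\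
      ~ covered (x + d *: face_normal (inr b));
  vol_size : exists2 c : R, 0 < c & forall K : elem T,
    ((c * mesh_size T ^+ N)%:E <= hausdorff N (cell K)
       <= (c^-1 * mesh_size T ^+ N)%:E)%E;
  area_size : exists2 c : R, 0 < c & forall f : face,
    ((c * mesh_size T ^+ N.-1)%:E <= hausdorff N.-1 (face_set f)
       <= (c^-1 * mesh_size T ^+ N.-1)%:E)%E;
  (* divergence theorem for constant fields on the polyhedron [cell K] *)
  cell_gauss : forall K : elem T,
    \sum_(s | inK s == K) area (inl s) *: face_normal (inl s)
    - \sum_(s | outK s == K) area (inl s) *: face_normal (inl s)
    + \sum_(b | ownK b == K) area (inr b) *: face_normal (inr b) = 0 }.

End Mesh.

(* A function of Q_h is given by its values on the elements; integrals over
   Omega_h and over faces of elementwise constant data are finite sums. *)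
Section DiscreteCalculus.
Variables (R : realType) (N : nat) (T : mesh_data R N).

Definition Qh (V : Type) := elem T -> V.

Definition vol_int (f : Qh R) : R := \sum_(K : elem T) vol K * f K.

Definition iface_int (f : iface T -> R) : R :=
  \sum_(s : iface T) area (inl s) * f s.

Definition bface_int (f : bface T -> R) : R :=
  \sum_(b : bface T) area (inr b) * f b.

Definition nrm (s : iface T) : 'rV[R]_N := face_normal (inl s).

Definition jump (V : zmodType) (v : Qh V) (s : iface T) : V :=
  v (outK s) - v (inK s).

Definition avg (v : Qh R) (s : iface T) : R := (v (inK s) + v (outK s)) / 2.

Definition avgv (v : Qh 'rV[R]_N) (s : iface T) : 'rV[R]_N :=
  2^-1 *: (v (inK s) + v (outK s)).

Section Velocity.
Variable u : Qh 'rV[R]_N.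

Definition unorm (s : iface T) : R := dot (avgv u s) (nrm s).

Definition Up (r : Qh R) (s : iface T) : R :=
  avg r s * unorm s - 2^-1 * `|unorm s| * jump r s.

Definition Upv (r : Qh 'rV[R]_N) (s : iface T) : 'rV[R]_N :=
  unorm s *: avgv r s - (2^-1 * `|unorm s|) *: jump r s.

Definition upval (r : Qh R) (s : iface T) : R :=
  if 0 <= unorm s then r (inK s) else r (outK s).

Definition downval (r : Qh R) (s : iface T) : R :=
  if 0 <= unorm s then r (outK s) else r (inK s).

Definition updown_jump (r : Qh R) (s : iface T) : R := upval r s - downval r s.

End Velocity.
End DiscreteCalculus.

(* Values (density, momentum, energy) of the unknowns on one element. *)
Definition cstate (R : realType) (N : nat) : Type := (R * 'rV[R]_N * R)%type.

Section Thermodynamics.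
Variables (R : realType) (N : nat) (gamma : R).
Implicit Type w : cstate R N.

Definition rho w : R := w.1.1.
Definition mom w : 'rV[R]_N := w.1.2.
Definition ene w : R := w.2.

Definition internal w : R := ene w - 2^-1 * (sqnorm (mom w) / rho w).

Definition admissible w : Prop := 0 < rho w /\ 0 < internal w.

Definition cv : R := (gamma - 1)^-1.

Definition vel w : 'rV[R]_N := (rho w)^-1 *: mom w.

Definition pres w : R := (gamma - 1) * internal w.

Definition temp w : R := pres w / rho w.

Definition entr w : R := ln (temp w `^ cv / rho w).

Definition renorm_entropy (chi : R -> R) (r p : R) : R :=
  r * chi (cv * ln (p / r `^ gamma)).

Definition grad_rho (chi : R -> R) w : R :=
  derive1 (fun r : R => renorm_entropy chi r (pres w)) (rho w).

Definition grad_p (chi : R -> R) w : R :=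
  derive1 (fun p : R => renorm_entropy chi (rho w) p) (pres w).

End Thermodynamics.

Section Scheme.
Variables (R : realType) (N : nat) (T : mesh_data R N) (gamma alpha : R).

(* The numerical viscosity of a face is a function of the two states adjacent to
   the face; this includes h M(h, avg rho, avg m, avg E). *)
Variable mu : iface T -> cstate R N -> cstate R N -> R.

Definition viscosity_ok : Prop := forall (s : iface T) (a b : cstate R N),
  admissible a -> admissible b ->
  0 <= mu s a b /\
  {for (a, b), continuous (fun z : cstate R N * cstate R N => mu s z.1 z.2)}.

Definition muh (U : Qh T (cstate R N)) (s : iface T) : R :=
  mu s (U (inK s)) (U (outK s)).

Let h : R := mesh_size T.

Section Equations.
Variable U : Qh T (cstate R N).
Let rhoh : Qh T R := fun K => rho (U K).
Let momh : Qh T 'rV[R]_N := fun K => mom (U K).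
Let eneh : Qh T R := fun K => ene (U K).
Let uh : Qh T 'rV[R]_N := fun K => vel (U K).
Let ph : Qh T R := fun K => pres gamma (U K).

Definition Fh (r : Qh T R) (s : iface T) : R :=
  Up uh r s - muh U s * jump r s.

Definition Fhv (r : Qh T 'rV[R]_N) (s : iface T) : 'rV[R]_N :=
  Upv uh r s - muh U s *: jump r s.

Definition continuity_eq (drho : Qh T R) : Prop := forall Phi : Qh T R,
  vol_int (fun K => drho K * Phi K)
  - iface_int (fun s => Fh rhoh s * jump Phi s) = 0.

(* The integral over the faces of the boundary carries the no-flux condition:
   there the face value of u . n vanishes, so that no mass, energy or convected
   momentum is transported, and the only flux left is the momentum flux p n, with
   p extrapolated from the adjacent element.  Without it the sums over interior
   faces alone would let a fluid at rest under constant pressure accelerate. *)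
Definition momentum_eq (dmom : Qh T 'rV[R]_N) : Prop :=
  forall Phi : Qh T 'rV[R]_N,
  vol_int (fun K => dot (dmom K) (Phi K))
  - iface_int (fun s => dot (Fhv momh s) (jump Phi s))
  - iface_int (fun s => avg ph s * dot (nrm s) (jump Phi s))
  + bface_int (fun b =>
      ph (ownK b) * dot (face_normal (inr b)) (Phi (ownK b)))
  = - (h `^ (alpha - 1)) *
      iface_int (fun s => dot (jump uh s) (jump Phi s)).

Definition energy_eq (dene : Qh T R) : Prop := forall Phi : Qh T R,
  vol_int (fun K => dene K * Phi K)
  - iface_int (fun s => Fh eneh s * jump Phi s)
  - iface_int (fun s =>
      avg ph s * dot (jump (fun K => Phi K *: uh K) s) (nrm s))
  + iface_int (fun s =>
      avg (fun K => ph K * Phi K) s * dot (jump uh s) (nrm s))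
  = - (h `^ (alpha - 1)) *
      iface_int (fun s => dot (jump uh s) (avgv uh s) * jump Phi s).

End Equations.

(* Solutions on [0, tmax).  The values at negative times are immaterial: the
   two-sided derivative at t = 0 amounts to the derivative from the right, since
   a function on [0, tmax) can be extended affinely to t < 0. *)
Definition solves (U : R -> Qh T (cstate R N)) (tmax : \bar R) : Prop :=
  forall t : R, 0 <= t -> (t%:E < tmax)%E ->
  [/\ forall K, derivable (fun x : R => rho (U x K)) t 1,
      forall K i, derivable (fun x : R => mom (U x K) ord0 i) t 1 &
      forall K, derivable (fun x : R => ene (U x K)) t 1] /\
  [/\ continuity_eq (U t) (fun K => derive1 (fun x : R => rho (U x K)) t),
      momentum_eq (U t)
        (fun K => \row_i derive1 (fun x : R => mom (U x K) ord0 i) t) &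
      energy_eq (U t) (fun K => derive1 (fun x : R => ene (U x K)) t)].

Definition admissible_on (U : R -> Qh T (cstate R N)) (tmax : \bar R) : Prop :=
  forall t : R, 0 <= t -> (t%:E < tmax)%E -> forall K, admissible (U t K).

(* The viscosity is regular enough for ODE theory: every admissible initial state
   has a unique admissible solution on a maximal time interval. *)
Definition ode_wellposed : Prop :=
  forall U0 : Qh T (cstate R N), (forall K, admissible (U0 K)) ->
  exists (tmax : \bar R) (U : R -> Qh T (cstate R N)),
    [/\ (0 < tmax)%E, solves U tmax, admissible_on U tmax, U 0 = U0 &
        forall (tV : \bar R) (V : R -> Qh T (cstate R N)),
          solves V tV -> admissible_on V tV -> V 0 = U0 ->
          (tV <= tmax)%E /\ forall t : R, 0 <= t -> (t%:E < tV)%E -> V t = U t].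

Definition renormalization (chi : R -> R) : Prop :=
  [/\ {homo chi : x y / x <= y},
      forall x y t : R, 0 <= t <= 1 ->
        t * chi x + (1 - t) * chi y <= chi (t * x + (1 - t) * y),
      [/\ forall x : R, derivable chi x 1,
          forall x : R, derivable (derive1 chi) x 1 &
          continuous (derive1 (derive1 chi))] &
      exists C : R, forall x : R, chi x <= C].

Section EntropyProduction.
Variables (chi : R -> R) (U : Qh T (cstate R N)) (Phi : Qh T R).
Let rhoh : Qh T R := fun K => rho (U K).
Let uh : Qh T 'rV[R]_N := fun K => vel (U K).
Let ph : Qh T R := fun K => pres gamma (U K).
Let th : Qh T R := fun K => temp gamma (U K).
Let sh : Qh T R := fun K => entr gamma (U K).
Let chi_sh : Qh T R := fun K => chi (sh K).
Let dchi_sh : Qh T R := fun K => derive1 chi (sh K).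
Let b (r : R) : R := r * ln r.
Let psi : Qh T R := fun K => dchi_sh K * Phi K / th K.
Let absu (s : iface T) : R := `|unorm uh s|.

Definition entropy_flux : R :=
  iface_int (fun s => Up uh (fun K => rhoh K * chi_sh K) s * jump Phi s).

Definition entropy_production : R :=
  h `^ (alpha - 1) * iface_int (fun s => sqnorm (jump uh s) * avg psi s)
  + 2^-1 * iface_int (fun s =>
      downval uh psi s * upval uh rhoh s * absu s * sqnorm (jump uh s))
  + iface_int (fun s =>
      muh U s * avg rhoh s * sqnorm (jump uh s) * avg psi s)
  + iface_int (fun s =>
      downval uh (fun K => dchi_sh K * Phi K) s *
      (updown_jump uh (fun K => b (rhoh K)) s
       - derive1 b (downval uh rhoh s) * updown_jump uh rhoh s) * absu s)
  - cv gamma * iface_int (fun s =>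
      downval uh (fun K => dchi_sh K * Phi K) s * upval uh rhoh s *
      (updown_jump uh (fun K => ln (th K)) s
       - (downval uh th s)^-1 * updown_jump uh th s) * absu s)
  - iface_int (fun s =>
      downval uh Phi s * upval uh rhoh s *
      (updown_jump uh chi_sh s
       - derive1 chi (downval uh sh s) * updown_jump uh sh s) * absu s)
  - iface_int (fun s =>
      muh U s * jump (fun K => Phi K * grad_rho gamma chi (U K)) s * jump rhoh s)
  - iface_int (fun s =>
      muh U s * jump (fun K => Phi K * grad_p gamma chi (U K)) s * jump ph s).

(* The diffusive fluxes dissipate, on each face, kinetic energy weighted by
   (rho^in psi^out + rho^out psi^in) / 2, which is the product of the averages
   of rho and psi minus [[rho]] [[psi]] / 4.  This is the last contribution; it
   vanishes if mu = 0, or if psi or rho is continuous across the faces. *)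
Definition entropy_cross_defect : R :=
  4^-1 * iface_int (fun s =>
    muh U s * jump rhoh s * sqnorm (jump uh s) * jump psi s).

End EntropyProduction.
End Scheme.

(* Main.v *)
(* Global existence is continuation.  On a bounded time interval mass (on every
   connected component of the graph of cells and faces) and total energy are
   conserved, which bounds the state from above.  For the lower bounds consider
     G = int ln rho + int (e + ln e),   e = E - |m|^2 / (2 rho).
   Testing the continuity equation with 1/rho and the internal energy equation
   with 1 + 1/e, the upwind terms cost at most a multiple of |u.n|, the numerical
   viscosity has a good sign, and the diffusion h^(alpha-1) [[u]]^2 is gained.  As
   u differs from its mass-weighted mean by a sum of jumps, the gain absorbs |u|,
   so G' >= -C and rho and e cannot reach 0 in finite time, whatever the growth of
   the viscosity mu.  The state then stays in a compact set of admissible states,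
   its rates of change are bounded, and it has an admissible limit from which the
   solution restarts.

   The entropy balance is the chain rule: the continuity equation tested with
   Phi d(rho chi)/d rho plus the internal energy equation tested with
   chi' Phi / theta is an identity face by face. *)
Require Import Defs.
From mathcomp Require Import all_boot all_order all_algebra.
From mathcomp Require Import all_classical all_reals all_analysis.
From mathcomp Require Import ring lra.
Import Order.TTheory GRing.Theory Num.Theory.
Import numFieldNormedType.Exports.

Local Open Scope classical_set_scope.
Local Open Scope ring_scope.

(** * Internal energy balance *)

Section Dot.
Set Implicit Arguments.
Unset Strict Implicit.
Variables (R : realType) (N : nat).
Implicit Types u v w : 'rV[R]_N.

Lemma dotC u v : dot u v = dot v u.
Proof. by apply: eq_bigr => i _; rewrite mulrC. Qed.

Lemma dotDl u v w : dot (u + v) w = dot u w + dot v w.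
Proof. by rewrite -big_split; apply: eq_bigr => i _; rewrite mxE mulrDl. Qed.

Lemma dotZl (a : R) u w : dot (a *: u) w = a * dot u w.
Proof. by rewrite /dot mulr_sumr; apply: eq_bigr => i _; rewrite mxE mulrA. Qed.

Lemma dotNl u w : dot (- u) w = - dot u w.
Proof. by rewrite -scaleN1r dotZl mulN1r. Qed.

Lemma dotDr u v w : dot w (u + v) = dot w u + dot w v.
Proof. by rewrite dotC dotDl !(dotC w). Qed.

Lemma dotZr (a : R) u w : dot w (a *: u) = a * dot w u.
Proof. by rewrite dotC dotZl (dotC w). Qed.

Lemma dotNr u w : dot w (- u) = - dot w u.
Proof. by rewrite dotC dotNl (dotC w). Qed.

Lemma dot0r w : dot w 0 = 0.
Proof. by rewrite -(scale0r w) dotZr mul0r. Qed.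

Lemma dot_sumr (I : Type) (r : seq I) (P : pred I) (F : I -> 'rV[R]_N) w :
  dot w (\sum_(i <- r | P i) F i) = \sum_(i <- r | P i) dot w (F i).
Proof. by apply: (big_morph (dot w)) => [u v|]; rewrite ?dotDr ?dot0r. Qed.

Lemma sqnorm_ge0 u : 0 <= sqnorm u.
Proof. by apply: sumr_ge0 => i _; rewrite -expr2 sqr_ge0. Qed.

Lemma sqr_coord_le u i : (u ord0 i) ^+ 2 <= sqnorm u.
Proof.
rewrite /sqnorm /dot (bigD1 i) //= -expr2 lerDl.
by apply: sumr_ge0 => j _; rewrite -expr2 sqr_ge0.
Qed.

Definition dotE := (dotDl, dotDr, dotNl, dotNr, dotZl, dotZr).

End Dot.

(** * Linearity of discrete integrals and summation by parts *)

Section Sums.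
Set Implicit Arguments.
Unset Strict Implicit.
Variables (R : realType) (N : nat) (T : mesh_data R N).

Lemma iface_intD f g :
  iface_int (T := T) f + iface_int g = iface_int (fun s => f s + g s).
Proof. by rewrite -big_split; apply: eq_bigr => s _; rewrite mulrDr. Qed.

Lemma iface_intN f : - iface_int (T := T) f = iface_int (fun s => - f s).
Proof. by rewrite -sumrN; apply: eq_bigr => s _; rewrite mulrN. Qed.

Lemma iface_intZ a f : a * iface_int (T := T) f = iface_int (fun s => a * f s).
Proof. by rewrite mulr_sumr; apply: eq_bigr => s _; rewrite mulrCA. Qed.

Lemma eq_iface_int f g : f =1 g -> iface_int (T := T) f = iface_int g.
Proof. by move=> fg; apply: eq_bigr => s _; rewrite fg. Qed.

Lemma vol_intD f g :
  vol_int (T := T) f + vol_int g = vol_int (fun s => f s + g s).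
Proof. by rewrite -big_split; apply: eq_bigr => s _; rewrite mulrDr. Qed.

Lemma vol_intN f : - vol_int (T := T) f = vol_int (fun s => - f s).
Proof. by rewrite -sumrN; apply: eq_bigr => s _; rewrite mulrN. Qed.

Lemma eq_vol_int f g : f =1 g -> vol_int (T := T) f = vol_int g.
Proof. by move=> fg; apply: eq_bigr => s _; rewrite fg. Qed.

(** Summation by parts: the closed-surface identity [cell_gauss] of each cell is dotted with the
    value of [X] there and summed over the cells. An interior face is met from both sides and
    collects minus its jump; a boundary face is met once. *)
Lemma bface_int_gauss (hT : regular_mesh T) (X : Qh T 'rV[R]_N) :
  bface_int (fun b => dot (X (ownK b)) (face_normal (inr b)))
  = iface_int (fun s => dot (jump X s) (nrm s)).
Proof.
have H : \sum_(K : elem T) dot (X K) 0 = 0.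
  by rewrite big1 // => K _; rewrite dot0r.
move: H; under eq_bigr => K _ do
  rewrite -(cell_gauss hT K) !dotE !dot_sumr.
rewrite !big_split /= sumrN.
have collect (I : finType) (g : I -> elem T) (n : I -> 'rV[R]_N) (a : I -> R) :
    \sum_(K : elem T) \sum_(s | g s == K) dot (X K) (a s *: n s)
    = \sum_s a s * dot (X (g s)) (n s).
  rewrite [RHS](partition_big g predT) //=.
  by apply: eq_bigr => K _; apply: eq_bigr => s /eqP <-; rewrite dotZr.
rewrite !collect => H.
apply/eqP; rewrite -subr_eq0; apply/eqP; rewrite -[RHS]H.
rewrite /iface_int (eq_bigr (fun s : iface T =>
    area (inl s) * dot (X (outK s)) (face_normal (inl s)) -
    area (inl s) * dot (X (inK s)) (face_normal (inl s)))); last first.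
  by move=> s _; rewrite /jump /nrm !dotE mulrBr.
by rewrite big_split /= sumrN opprB addrC.
Qed.

End Sums.

(** * Internal energy equation with an arbitrary elementwise test function *)

Section InternalEnergy.
Set Implicit Arguments.
Unset Strict Implicit.
Variables (R : realType) (N : nat) (T : mesh_data R N) (gamma alpha : R).
Variables (mu : iface T -> cstate R N -> cstate R N -> R).
Variables (U : Qh T (cstate R N)) (dr : Qh T R) (dm : Qh T 'rV[R]_N)
  (dE : Qh T R).
Hypothesis hT : regular_mesh T.
Hypothesis rho_gt0 : forall K, 0 < rho (U K).
Hypothesis hC : continuity_eq mu U dr.
Hypothesis hM : momentum_eq gamma alpha mu U dm.
Hypothesis hE : energy_eq gamma alpha mu U dE.

Local Notation uh := (fun K => vel (U K)).
Local Notation rhoh := (fun K => rho (U K)).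
Local Notation eh := (fun K => internal (U K)).
Local Notation ph := (fun K => pres gamma (U K)).
Local Notation h := (mesh_size T).

(** The chain rule for [E - |m|^2 / (2 rho)] applied to given rates of density, momentum and
    energy. *)
Definition dinternal (K : elem T) : R :=
  dE K - dot (vel (U K)) (dm K) + 2^-1 * sqnorm (vel (U K)) * dr K.

(** Kinetic energy turned into heat on a face, in order, by the velocity diffusion, by upwinding and
    by the numerical viscosity. In the last term each density is weighted by the test function of
    the opposite cell. *)
Definition dissipation (Phi : Qh T R) (s : iface T) : R :=
  h `^ (alpha - 1) * (sqnorm (jump uh s) * avg Phi s)
  + 2^-1 * (downval uh Phi s * upval uh rhoh s * `|unorm uh s|
            * sqnorm (jump uh s))
  + muh mu U s * sqnorm (jump uh s)
    * ((rho (U (inK s)) * Phi (outK s) + rho (U (outK s)) * Phi (inK s)) / 2).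

Lemma momE K : mom (U K) = rho (U K) *: vel (U K).
Proof. by rewrite /vel scalerA divff ?scale1r // gt_eqF. Qed.

Lemma eneE K : ene (U K) =
  internal (U K) + 2^-1 * rho (U K) * sqnorm (vel (U K)).
Proof.
rewrite /internal {1}momE /sqnorm !dotE.
have := gt_eqF (rho_gt0 K); set r := rho _ => /negbT r0.
by field.
Qed.

(** The energy equation tested with [Phi], minus the momentum equation tested with [Phi u], plus the
    continuity equation tested with [|u|^2 Phi / 2]. By Gauss the wall pressure becomes interior
    jumps of [p Phi u], and the discrete product rule leaves only the jump of [p Phi] times the mean
    normal velocity. *)
Lemma internal_balance (Phi : Qh T R) :
  vol_int (fun K => dinternal K * Phi K) =
  iface_int (fun s => (Up uh eh s - muh mu U s * jump eh s) * jump Phi s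
    + jump (fun K => ph K * Phi K) s * unorm uh s
    + dissipation Phi s).
Proof.
have HE := hE Phi.
have HM := hM (fun K => Phi K *: vel (U K)).
have HC := hC (fun K => 2^-1 * sqnorm (vel (U K)) * Phi K).
have HB : bface_int (fun b => ph (ownK b) *
      dot (face_normal (inr b)) (Phi (ownK b) *: vel (U (ownK b)))) =
    iface_int (fun s =>
      dot (jump (fun K => (ph K * Phi K) *: vel (U K)) s) (nrm s)).
  rewrite -bface_int_gauss //; apply: eq_bigr => b _.
  by congr (_ * _); rewrite dotC !dotZl mulrA.
rewrite HB in HM.
have -> : vol_int (fun K => dinternal K * Phi K) =
    vol_int (fun K => dE K * Phi K)
    - vol_int (fun K => dot (dm K) (Phi K *: vel (U K)))
    + vol_int (fun K => dr K * (2^-1 * sqnorm (vel (U K)) * Phi K)).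
  rewrite vol_intN !vol_intD; apply: eq_vol_int => K.
  by rewrite /dinternal dotZr (dotC (dm K)); ring.
have isolate (a b c d e : R) : a - b - c + d = e -> a = e + b + c - d.
  by move=> <-; ring.
move/isolate: HE => HE; move/isolate: HM => HM.
move/eqP: HC; rewrite subr_eq add0r => /eqP HC.
have lin (a b c a' b' c' : R) : a = a' -> b = b' -> c = c' ->
  a - b + c = a' - b' + c' by move=> -> -> ->.
rewrite (lin _ _ _ _ _ _ HE HM HC) {lin}.
rewrite !mulNr !iface_intZ !(iface_intN, iface_intD).
apply: eq_iface_int => s.
rewrite /Fh /Fhv /dissipation /Up /Upv /upval /downval.
have : unorm uh s = (dot (vel (U (inK s))) (nrm s)
    + dot (vel (U (outK s))) (nrm s)) / 2.
  by rewrite /unorm /avgv !dotE mulrC.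
set w := unorm uh s; clearbody w.
rewrite /jump /avg /avgv /sqnorm /= !momE !eneE /pres /sqnorm.
move: (vel (U (inK s))) (vel (U (outK s))) => va vb.
rewrite !dotE !(dotC (nrm s)) !(dotC vb va) => wE.
(* One normal velocity is eliminated in favour of the mean [w]; once the sign of [w] fixes the
   upwind side, the face identity is algebraic. *)
have {wE} vbE : dot vb (nrm s) = 2 * w - dot va (nrm s) by rewrite wE; field.
rewrite !{}vbE.
by case: (ger0P w) => hw; field.
Qed.

End InternalEnergy.

(** * Renormalized entropy balance *)

Section RealDerivatives.
Set Implicit Arguments.
Unset Strict Implicit.
Variable R : realType.
Implicit Types (f g : R -> R) (x a b : R).

Lemma is_derive_add f g x a b : is_derive x 1 f a -> is_derive x 1 g b ->
  is_derive x 1 (fun y => f y + g y) (a + b).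
Proof. exact: is_deriveD. Qed.

Lemma is_derive_mul f g x a b : is_derive x 1 f a -> is_derive x 1 g b ->
  is_derive x 1 (fun y => f y * g y) (f x * b + g x * a).
Proof. exact: is_deriveM. Qed.

Lemma is_derive_scale c f x a : is_derive x 1 f a ->
  is_derive x 1 (fun y => c * f y) (c * a).
Proof. exact: is_deriveZ. Qed.

Lemma is_derive_bigsum (I : Type) (r : seq I) (F : I -> R -> R) (dF : I -> R) x :
  (forall i, is_derive x 1 (F i) (dF i)) ->
  is_derive x 1 (fun y => \sum_(i <- r) F i y) (\sum_(i <- r) dF i).
Proof.
move=> FdF; elim: r => [|i r IH].
  rewrite big_nil; under eq_fun do rewrite big_nil; exact: is_derive_cst.
rewrite big_cons; under eq_fun do rewrite big_cons.
exact: is_derive_add.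
Qed.

Lemma is_derive_inv f x a : f x != 0 -> is_derive x 1 f a ->
  is_derive x 1 (fun y => (f y)^-1) (- a / f x ^+ 2).
Proof.
move=> fx0 fa; have := is_deriveV fx0 fa.
rewrite (_ : _ *: a = - a / f x ^+ 2); last first.
  by rewrite /GRing.scale /= mulNr mulrC mulNr.
exact.
Qed.

Lemma is_derive_ln f x a : 0 < f x -> is_derive x 1 f a ->
  is_derive x 1 (fun y => ln (f y)) (a / f x).
Proof.
move=> fx0 fa; rewrite mulrC.
exact: (is_derive1_comp (is_derive1_ln fx0) fa).
Qed.

Lemma is_derive_cvg f x a : is_derive x 1 f a -> f y @[y --> x] --> f x.
Proof. by case=> /derivable1_diffP /differentiable_continuous. Qed.

Lemma is_derive_gt0 f x a : is_derive x 1 f a -> 0 < f x ->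
  \forall y \near x, 0 < f y.
Proof. by move=> /is_derive_cvg fc f0; exact: (cvgr_gt (f x) fc). Qed.

Lemma derivable_is_derive f x : derivable f x 1 -> is_derive x 1 f (derive1 f x).
Proof. by move=> /derivableP; rewrite derive1E. Qed.

Lemma is_derive_derive1 f x a : is_derive x 1 f a -> derive1 f x = a.
Proof. by rewrite derive1E => -[_ <-]. Qed.

Lemma MVT_ge f df a b m : a <= b ->
  (forall x, a <= x <= b -> is_derive x 1 f (df x)) ->
  (forall x, a < x < b -> m <= df x) -> m * (b - a) <= f b - f a.
Proof.
rewrite le_eqVlt => /orP[/eqP <- _ _|ab fdf dfm]; first by rewrite !subrr mulr0.
have [x | |c] := @MVT R f df a b ab.
- by rewrite in_itv /= => /andP[ax xb]; apply: fdf; rewrite !ltW.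
- apply: derivable_within_continuous => x; rewrite in_itv /=.
  by case/fdf.
by rewrite in_itv /= => cab ->; rewrite ler_pM2r ?subr_gt0 ?dfm.
Qed.

Lemma MVT_norm_le f df a b m : a <= b ->
  (forall x, a <= x <= b -> is_derive x 1 f (df x)) ->
  (forall x, a < x < b -> `|df x| <= m) -> `|f b - f a| <= m * (b - a).
Proof.
move=> ab fdf dfm; rewrite ler_norml -mulNr; apply/andP; split.
  by apply: (MVT_ge ab fdf) => x /dfm; rewrite ler_norml => /andP[].
rewrite -subr_ge0 (_ : _ - _ = (- f b - - f a) - - m * (b - a)); last by ring.
rewrite subr_ge0.
apply: (@MVT_ge (fun x => - f x) (fun x => - df x)) => // [x xab|x /dfm].
  exact/is_deriveN/fdf.
by rewrite ler_norml lerN2 => /andP[].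
Qed.

End RealDerivatives.

(** * Derivatives of the renormalized entropy in density and pressure *)

Section RenormalizedEntropy.
Set Implicit Arguments.
Unset Strict Implicit.
Variables (R : realType) (N : nat) (gamma : R) (chi : R -> R).
Hypothesis gamma_gt1 : 1 < gamma.
Hypothesis dchi : forall x, derivable chi x 1.
Implicit Type w : cstate R N.

Local Notation cv := (cv gamma).

Lemma ln_entropyE (r p : R) : 0 < r -> 0 < p ->
  cv * ln (p / r `^ gamma) = cv * (ln p - gamma * ln r).
Proof.
by move=> r0 p0; rewrite ln_div ?posrE ?powR_gt0 // ln_powR.
Qed.

Lemma pres_gt0 w : admissible w -> 0 < pres gamma w.
Proof. by move=> [_ ?]; rewrite mulr_gt0 // subr_gt0. Qed.

Lemma temp_gt0 w : admissible w -> 0 < temp gamma w.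
Proof. by move=> aw; rewrite divr_gt0 ?pres_gt0 //; case: aw. Qed.

Lemma entrE w : admissible w ->
  entr gamma w = cv * ln (temp gamma w) - ln (rho w).
Proof.
move=> aw; rewrite /entr ln_div ?posrE ?powR_gt0 ?temp_gt0 ?ln_powR //.
by case: aw.
Qed.

Lemma entr_presE w : admissible w ->
  entr gamma w = cv * ln (pres gamma w / rho w `^ gamma).
Proof.
move=> aw; have r0 : 0 < rho w by case: aw.
have p0 := pres_gt0 aw.
rewrite entrE // ln_entropyE // /temp ln_div ?posrE // /Defs.cv.
by field; rewrite subr_eq0 gt_eqF.
Qed.

Lemma is_derive_renorm_entropy (r p : R -> R) (x dr dp : R) :
  0 < r x -> 0 < p x -> is_derive x 1 r dr -> is_derive x 1 p dp ->
  let s := cv * ln (p x / r x `^ gamma) in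
  is_derive x 1 (fun y => renorm_entropy gamma chi (r y) (p y))
    ((chi s - gamma * cv * derive1 chi s) * dr + cv * r x / p x * derive1 chi s * dp).
Proof.
move=> r0 p0 rdr pdp s.
(* The logarithm of the quotient splits only for positive arguments; positivity at [x] persists
   nearby by continuity. *)
apply: (@near_eq_is_derive _ _ _
  (fun y => r y * chi (cv * (ln (p y) + (- gamma) * ln (r y))))).
  have rn := is_derive_gt0 rdr r0; have pn := is_derive_gt0 pdp p0.
  near=> y; rewrite /renorm_entropy ln_entropyE ?mulNr //; first by near: y.
  by near: y.
have ds : is_derive x 1 (fun y => cv * (ln (p y) + (- gamma) * ln (r y)))
    (cv * (dp / p x + (- gamma) * (dr / r x))).
  by apply/is_derive_scale/is_derive_add; [|apply: is_derive_scale];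
     exact: is_derive_ln.
have sE : s = cv * (ln (p x) + (- gamma) * ln (r x)).
  by rewrite /s ln_entropyE // mulNr.
have dc : is_derive s 1 chi (derive1 chi s) by exact: derivable_is_derive.
rewrite sE in dc.
have dcs := @is_derive1_comp R chi
  (fun y => cv * (ln (p y) + (- gamma) * ln (r y))) x _ _ dc ds.
refine (is_derive_eq (is_derive_mul rdr dcs) _).
by rewrite /= -sE; field; rewrite !gt_eqF.
Unshelve. all: by end_near. Qed.

Lemma grad_rhoE w : admissible w -> grad_rho gamma chi w =
  chi (entr gamma w) - gamma * cv * derive1 chi (entr gamma w).
Proof.
move=> aw; have r0 : 0 < rho w by case: aw.
rewrite entr_presE //; apply: is_derive_derive1; apply: is_derive_eq.
  by apply: (@is_derive_renorm_entropy id (cst (pres gamma w)));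
     rewrite ?pres_gt0.
by rewrite mulr0 addr0 mulr1.
Qed.

(** As [p = (gamma - 1) e], the left side is the derivative with respect to the internal energy at
    fixed density. This identifies the test function [chi' Phi / theta] for the internal energy
    equation. *)
Lemma grad_pE w : admissible w ->
  (gamma - 1) * grad_p gamma chi w = derive1 chi (entr gamma w) / temp gamma w.
Proof.
move=> aw; have r0 : 0 < rho w by case: aw.
have p0 := pres_gt0 aw; have g1 : gamma - 1 != 0 by rewrite subr_eq0 gt_eqF.
rewrite entr_presE //; rewrite (_ : grad_p _ _ _ =
  cv * rho w / pres gamma w * derive1 chi (cv * ln (pres gamma w / rho w `^ gamma))).
  by rewrite /temp /Defs.cv; field; rewrite g1 !gt_eqF.
apply: is_derive_derive1; apply: is_derive_eq.
  by apply: (@is_derive_renorm_entropy (cst (rho w)) id); rewrite ?r0.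
by rewrite mulr0 add0r mulr1.
Qed.

End RenormalizedEntropy.

Lemma derive1_xlnx (R : realType) (r : R) : 0 < r ->
  derive1 (fun x : R => x * ln x) r = ln r + 1.
Proof.
move=> r0; apply: is_derive_derive1.
refine (is_derive_eq (is_derive_mul (is_derive_id r 1) (is_derive1_ln r0)) _).
by rewrite mulfV ?gt_eqF // mulr1 addrC.
Qed.

(** * From the identity on each face to the balance in time *)

Section EntropyBalance.
Set Implicit Arguments.
Unset Strict Implicit.
Variables (R : realType) (N : nat) (T : mesh_data R N) (gamma alpha : R).
Variables (mu : iface T -> cstate R N -> cstate R N -> R) (chi : R -> R).
Hypothesis hT : regular_mesh T.
Hypothesis gamma_gt1 : 1 < gamma.
Hypothesis dchi : forall x, derivable chi x 1.

Section Fluxes.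
Variables (U : Qh T (cstate R N)) (dr : Qh T R) (dm : Qh T 'rV[R]_N)
  (dE : Qh T R).
Hypothesis admU : forall K, admissible (U K).
Hypothesis hC : continuity_eq mu U dr.
Hypothesis hM : momentum_eq gamma alpha mu U dm.
Hypothesis hE : energy_eq gamma alpha mu U dE.

(** The defect appears because the viscous dissipation carries the crossed weight of [dissipation],
    while [entropy_production] uses the product of the averages of [rho] and [psi]. *)
Lemma entropy_balance_fluxes (Phi : Qh T R) :
  vol_int (fun K => (grad_rho gamma chi (U K) * dr K
    + grad_p gamma chi (U K) * ((gamma - 1) * dinternal U dr dm dE K)) * Phi K)
  - entropy_flux gamma chi U Phi
  = entropy_production gamma alpha mu chi U Phi
    - entropy_cross_defect gamma mu chi U Phi.
Proof.
have rho_gt0 K : 0 < rho (U K) by case: (admU K).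
have HC := hC (fun K => grad_rho gamma chi (U K) * Phi K).
have HI := internal_balance hT rho_gt0 hC hM hE
  (fun K => derive1 chi (entr gamma (U K)) * Phi K / temp gamma (U K)).
move/eqP: HC; rewrite subr_eq add0r => /eqP HC.
have -> : vol_int (fun K => (grad_rho gamma chi (U K) * dr K
    + grad_p gamma chi (U K) * ((gamma - 1) * dinternal U dr dm dE K)) * Phi K) =
  vol_int (fun K => dr K * (grad_rho gamma chi (U K) * Phi K)) +
  vol_int (fun K => dinternal U dr dm dE K *
    (derive1 chi (entr gamma (U K)) * Phi K / temp gamma (U K))).
  rewrite vol_intD; apply: eq_vol_int => K.
  rewrite -[_ * Phi K / _]mulrAC -grad_pE //; ring.
rewrite {}HC {}HI /entropy_flux /entropy_production /entropy_cross_defect.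
rewrite !iface_intZ !(iface_intN, iface_intD).
apply: eq_iface_int => s.
(* Pressure and internal energy are expressed through [theta], [rho] and [c_v], and [gamma c_v] is
   replaced by [1 + c_v], so that both sides become rational in the same quantities. *)
have gradpE w : admissible w -> grad_p gamma chi w =
    cv gamma * (derive1 chi (entr gamma w) / temp gamma w).
  by move=> aw; rewrite -grad_pE // mulKf // subr_eq0 gt_eqF.
have presE K : pres gamma (U K) = temp gamma (U K) * rho (U K).
  by rewrite /temp divfK // gt_eqF.
have intE K : internal (U K) = cv gamma * (temp gamma (U K) * rho (U K)).
  by rewrite -presE /pres mulKf // subr_eq0 gt_eqF.
have cvg : (gamma - 1) * cv gamma = 1 by rewrite divff // subr_eq0 gt_eqF.
have {}cvg : gamma * cv gamma = 1 + cv gamma by rewrite -cvg; ring.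
rewrite /Fh /dissipation /Up /upval /downval /updown_jump /upval /downval.
rewrite /jump /avg /=; set w := unorm _ s; set D := sqnorm _; clearbody D w.
rewrite !derive1_xlnx //; last by case: ifP.
rewrite !grad_rhoE // !gradpE // !presE !intE !cvg.
have ta0 := temp_gt0 gamma_gt1 (admU (inK s)).
have tb0 := temp_gt0 gamma_gt1 (admU (outK s)).
(* The sign of [w] decides which cell is upstream. The values of [chi] and [chi'] are generalized
   first, so that only the bare entropies are expanded into logarithms, which then act as
   independent variables. *)
by case: (ger0P w) => hw;
  move: (chi (entr _ (U (inK s)))) (chi (entr _ (U (outK s))))
    (derive1 chi (entr _ (U (inK s)))) (derive1 chi (entr _ (U (outK s))))
    => ca cb da db; rewrite !entrE //; field; rewrite !gt_eqF.
Qed.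

End Fluxes.

Lemma is_derive_internal (V : R -> cstate R N) (t dr dE : R) (dm : 'rV[R]_N) :
  0 < rho (V t) ->
  is_derive t 1 (fun x => rho (V x)) dr ->
  (forall i, is_derive t 1 (fun x => mom (V x) ord0 i) (dm ord0 i)) ->
  is_derive t 1 (fun x => ene (V x)) dE ->
  is_derive t 1 (fun x => internal (V x))
    (dE - dot (vel (V t)) dm + 2^-1 * sqnorm (vel (V t)) * dr).
Proof.
move=> r0 hr hm hE.
have hr' := is_derive_inv (lt0r_neq0 r0) hr.
have hs : is_derive t 1 (fun x => sqnorm (mom (V x)))
    (\sum_i (mom (V t) ord0 i * dm ord0 i + mom (V t) ord0 i * dm ord0 i)).
  by apply: is_derive_bigsum => i; apply: is_derive_mul.
rewrite (_ : (fun x => internal (V x)) = (fun x => ene (V x)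
    + - 2^-1 * (sqnorm (mom (V x)) * (rho (V x))^-1))); last first.
  by apply/funext => x; rewrite mulNr.
refine (is_derive_eq (is_derive_add hE
  (is_derive_scale (- 2^-1) (is_derive_mul hs hr'))) _) => /=.
rewrite big_split /= -/(dot _ _) /vel /sqnorm !dotE.
by field; rewrite gt_eqF.
Qed.

Lemma entropy_balance (V : R -> Qh T (cstate R N)) (t : R) (dr : Qh T R)
    (dm : Qh T 'rV[R]_N) (dE Phi : Qh T R) :
  (forall K, admissible (V t K)) ->
  (forall K, is_derive t 1 (fun x => rho (V x K)) (dr K)) ->
  (forall K i, is_derive t 1 (fun x => mom (V x K) ord0 i) (dm K ord0 i)) ->
  (forall K, is_derive t 1 (fun x => ene (V x K)) (dE K)) ->
  continuity_eq mu (V t) dr -> momentum_eq gamma alpha mu (V t) dm ->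
  energy_eq gamma alpha mu (V t) dE ->
  is_derive t 1 (fun x => vol_int (fun K =>
      rho (V x K) * chi (entr gamma (V x K)) * Phi K))
    (entropy_flux gamma chi (V t) Phi
     + (entropy_production gamma alpha mu chi (V t) Phi
        - entropy_cross_defect gamma mu chi (V t) Phi)).
Proof.
move=> admV hr hm hE eC eM eE.
rewrite -(entropy_balance_fluxes admV eC eM eE) addrC subrK.
apply: is_derive_bigsum => K; apply: is_derive_scale.
rewrite mulrC; under eq_fun do rewrite mulrC.
apply: is_derive_scale.
have rho_gt0 : 0 < rho (V t K) by case: (admV K).
have p_gt0 := pres_gt0 gamma_gt1 (admV K).
have di := is_derive_internal rho_gt0 (hr K) (hm K) (hE K).
have dp : is_derive t 1 (fun x => pres gamma (V x K))
  ((gamma - 1) * dinternal (V t) dr dm dE K) by exact: is_derive_scale.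
(* The two expressions of the entropy agree at admissible states, and admissibility persists near
   [t]. *)
apply: (@near_eq_is_derive _ _ _
  (fun x => renorm_entropy gamma chi (rho (V x K)) (pres gamma (V x K)))).
  have rn := is_derive_gt0 (hr K) rho_gt0.
  have pn : 0 < internal (V t K) by case: (admV K).
  have {}pn := is_derive_gt0 di pn.
  near=> x; rewrite /renorm_entropy entr_presE //; split; near: x; [exact: rn|exact: pn].
refine (is_derive_eq
  (@is_derive_renorm_entropy R gamma chi dchi (fun x => rho (V x K))
    (fun x => pres gamma (V x K)) t _ _ rho_gt0 p_gt0 (hr K) dp) _).
have gradpE : grad_p gamma chi (V t K) = cv gamma * rho (V t K)
    / pres gamma (V t K) * derive1 chi (entr gamma (V t K)).
  apply: (mulfI (lt0r_neq0 (_ : 0 < gamma - 1))); rewrite ?subr_gt0 //.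
  rewrite grad_pE // /temp /Defs.cv.
  by field; rewrite subr_eq0 !gt_eqF.
by rewrite -entr_presE // gradpE grad_rhoE.
Unshelve. all: by end_near. Qed.

End EntropyBalance.

(** * A priori bounds *)

Section FaceGraph.
Set Implicit Arguments.
Unset Strict Implicit.
Variables (R : realType) (N : nat) (T : mesh_data R N).

(** [fine] sends infinite values to 0; the upper bound is what excludes [+oo]. *)
Lemma fine_gt0_between (x : \bar R) (a b : R) :
  0 < a -> (a%:E <= x <= b%:E)%E -> 0 < fine x.
Proof.
move=> a0; case: x => [r||] /=.
- by rewrite lee_fin => /andP[/(lt_le_trans a0)].
- by case/andP=> _; rewrite leye_eq.
- by [].
Qed.

Lemma vol_gt0 (hT : regular_mesh T) K : 0 < vol (T := T) K.
Proof.
have [c c0 /(_ K)] := vol_size hT; apply: fine_gt0_between.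
by rewrite mulr_gt0 // exprn_gt0 // (mesh_size_gt0 hT).
Qed.

Lemma area_gt0 (hT : regular_mesh T) f : 0 < area (T := T) f.
Proof.
have [c c0 /(_ f)] := area_size hT; apply: fine_gt0_between.
by rewrite mulr_gt0 // exprn_gt0 // (mesh_size_gt0 hT).
Qed.

Definition adjacent : rel (elem T) := fun K L =>
  [exists s : iface T, ((inK s == K) && (outK s == L))
                       || ((inK s == L) && (outK s == K))].

(** The indicator of a component is taken in [Qh] to serve as a test function: having no jumps, it
    yields a conserved mass. *)
Definition component (K : elem T) : Qh T R := fun L => (connect adjacent K L)%:R.

Lemma jump_component K s : jump (component K) s = 0.
Proof.
have a1 : adjacent (inK s) (outK s) by apply/existsP; exists s; rewrite !eqxx.
have a2 : adjacent (outK s) (inK s).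
  by apply/existsP; exists s; rewrite !eqxx orbT.
rewrite /jump /component.
suff -> : connect adjacent K (outK s) = connect adjacent K (inK s).
  by rewrite subrr.
by apply/idP/idP => h; apply: connect_trans h _; apply: connect1.
Qed.

(** A path can be shortened to visit each cell at most once, so it has at most [#|elem T|] steps;
    the difference telescopes along it at a cost of [S] per face crossed. *)
Lemma connect_jump_le (v : Qh T R) (S : R) K L : 0 <= S ->
  (forall s, `|jump v s| <= S) -> connect adjacent K L ->
  `|v K - v L| <= #|elem T|%:R * S.
Proof.
move=> S0 vS /connectP[p /shortenP[q pq uq _] ->].
have {uq} qn : (size q <= #|elem T|)%N.
  by apply: leq_trans (max_card [in K :: q]); rewrite (card_uniqP uq) leqnSn.
apply: (@le_trans _ _ ((size q)%:R * S)); last by rewrite ler_wpM2r // ler_nat.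
elim: q K {qn p} pq => [K _|M q IH K /= /andP[KM Mq]].
  by rewrite subrr normr0 mul0r.
rewrite -(subrKA (v M)) (le_trans (ler_normD _ _)) //.
rewrite -natr1 mulrDl mul1r addrC lerD ?IH //.
case/existsP: KM => s /orP[] /andP[/eqP <- /eqP <-]; last exact: vS.
by rewrite distrC; exact: vS.
Qed.

End FaceGraph.

(** * Lower bound for the rate of the logarithmic functional *)

Section EntropyProductionBound.
Set Implicit Arguments.
Unset Strict Implicit.
Variables (R : realType) (N : nat) (T : mesh_data R N) (gamma alpha : R).
Variables (mu : iface T -> cstate R N -> cstate R N -> R).
Hypothesis hT : regular_mesh T.
Hypothesis gamma_gt1 : 1 < gamma.
Hypothesis hmu : viscosity_ok mu.

Local Notation n := #|elem T|%:R.

Definition jump_sum (u : Qh T 'rV[R]_N) : R :=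
  \sum_(s : iface T) \sum_(i < N) `|jump u s ord0 i|.

Lemma jump_le_jump_sum (u : Qh T 'rV[R]_N) s i :
  `|jump u s ord0 i| <= jump_sum u.
Proof.
rewrite /jump_sum (bigD1 s) //= (bigD1 i) //= -addrA lerDl addr_ge0 //.
  exact: sumr_ge0.
by apply: sumr_ge0 => s' _; apply: sumr_ge0.
Qed.

Lemma jump_sum_ge0 (u : Qh T 'rV[R]_N) : 0 <= jump_sum u.
Proof. by apply: sumr_ge0 => s _; apply: sumr_ge0. Qed.

(* On a connected component the mass-weighted mean velocity is the total momentum
   over the total mass, and the velocity differs from its mean by the jumps. *)
Lemma velocity_bound (U : Qh T (cstate R N)) (m1 M0 : R) K i :
  (forall L, 0 < rho (U L)) -> (forall L, `|mom (U L) ord0 i| <= m1) ->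
  0 < M0 -> M0 <= vol_int (fun L => rho (U L) * component K L) ->
  `|vel (U K) ord0 i| <= n * jump_sum (fun L => vel (U L))
    + (\sum_L vol (T := T) L) * m1 / M0.
Proof.
move=> r0 mm M00; set M := vol_int _ => M0M.
have M_gt0 : 0 < M := lt_le_trans M00 M0M.
set u := fun L => vel (U L).
have uE : M * u K ord0 i =
  (\sum_L vol L * (rho (U L) * component K L) * (u K ord0 i - u L ord0 i))
   + \sum_L vol L * component K L * mom (U L) ord0 i.
  rewrite /M /vol_int mulr_suml -big_split /=; apply: eq_bigr => L _.
  have -> : mom (U L) ord0 i = rho (U L) * u L ord0 i.
    by rewrite /u /vel mxE mulVKf // gt_eqF.
  ring.
have m1_ge0 : 0 <= m1 by exact: le_trans (mm K).
have comp01 L : 0 <= component K L <= 1.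
  by rewrite /component; case: connect; rewrite ?lexx ?ler01.
have weight_ge0 L : 0 <= vol L * (rho (U L) * component K L).
  by case/andP: (comp01 L) => c0 _; rewrite !mulr_ge0 // ltW // vol_gt0.
have : M * `|u K ord0 i| <= M * (n * jump_sum u) + (\sum_L vol (T := T) L) * m1.
  rewrite -{1}(gtr0_norm M_gt0) -normrM uE  (le_trans (ler_normD _ _)) //.
  rewrite lerD //.
    rewrite /M /vol_int mulr_suml (le_trans (ler_norm_sum _ _ _)) //.
    apply: ler_sum => L _; rewrite normrM (ger0_norm (weight_ge0 L)).
    case: (boolP (connect (@adjacent _ _ T) K L)) => KL; last first.
      by rewrite /component (negbTE KL) !mulr0 !mul0r.
    rewrite ler_wpM2l ?weight_ge0 //.
    apply: (@connect_jump_le _ _ _ (fun L => u L ord0 i)) => //.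
      exact: jump_sum_ge0.
    by move=> s; rewrite /jump; have := jump_le_jump_sum u s i; rewrite !mxE.
  rewrite mulr_suml (le_trans (ler_norm_sum _ _ _)) //.
  apply: ler_sum => L _; rewrite !normrM (gtr0_norm (vol_gt0 hT L)) -mulrA.
  rewrite ler_wpM2l ?(ltW (vol_gt0 hT L)) // -[leRHS]mul1r ler_pM //.
  by rewrite ger0_norm; case/andP: (comp01 L).
rewrite -ler_pdivlMl // mulrDr mulKf ?gt_eqF // => /le_trans; apply.
rewrite lerD2l mulrC ler_wpM2l //.
  by rewrite mulr_ge0 // sumr_ge0 // => L _; rewrite ltW // vol_gt0.
by rewrite lef_pV2 ?posrE.
Qed.

(** The upwind flux carries the upstream value, so testing with reciprocals gives
    [|w| (up / down - 1)], while the viscosity contributes the nonnegative [m (b - a)^2 / (a b)]. *)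
Lemma upwind_log_ge (a b w m : R) : 0 < a -> 0 < b -> 0 <= m ->
  - `|w| <= ((a + b) / 2 * w - 2^-1 * `|w| * (b - a) - m * (b - a))
            * (b^-1 - a^-1).
Proof.
move=> a0 b0 m0; rewrite -subr_ge0.
have d0 : 0 <= m * (b - a) ^+ 2 / (a * b).
  by apply: divr_ge0; [rewrite mulr_ge0 ?sqr_ge0|rewrite ltW ?mulr_gt0].
have /ltW ab : 0 < a / b by rewrite divr_gt0.
have /ltW ba : 0 < b / a by rewrite divr_gt0.
case: (ger0P w) => hw.
  rewrite (_ : _ - _ = w * (a / b) + m * (b - a) ^+ 2 / (a * b)).
    by rewrite addr_ge0 // mulr_ge0.
  by field; rewrite !gt_eqF.
rewrite (_ : _ - _ = - w * (b / a) + m * (b - a) ^+ 2 / (a * b)).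
  by rewrite addr_ge0 // mulr_ge0 // oppr_ge0 ltW.
by field; rewrite !gt_eqF.
Qed.

Section State.
Variables (U : Qh T (cstate R N)) (dr : Qh T R) (dm : Qh T 'rV[R]_N)
  (dE : Qh T R).
Hypothesis admU : forall K, admissible (U K).
Hypothesis hC : continuity_eq mu U dr.
Hypothesis hM : momentum_eq gamma alpha mu U dm.
Hypothesis hE : energy_eq gamma alpha mu U dE.

Local Notation uh := (fun K => vel (U K)).

Lemma dissipation_ge (Phi : Qh T R) s : (forall K, 1 <= Phi K) ->
  mesh_size T `^ (alpha - 1) * sqnorm (jump uh s)
  <= dissipation alpha mu U Phi s.
Proof.
move=> Phi1; have Phi0 K : 0 <= Phi K := le_trans ler01 (Phi1 K).
have r0 K : 0 <= rho (U K) by case: (admU K) => /ltW.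
rewrite /dissipation -addrA -[leLHS]addr0 lerD //.
  rewrite ler_wpM2l ?powR_ge0 // -{1}[sqnorm _]mulr1 ler_wpM2l ?sqnorm_ge0 //.
  by rewrite /avg ler_pdivlMr // mul1r (natrD _ 1 1) lerD.
have [mu0 _] := hmu s (admU (inK s)) (admU (outK s)).
rewrite addr_ge0 // ?mulr_ge0 ?sqnorm_ge0 ?addr_ge0 ?mulr_ge0 //.
  by rewrite /downval; case: ifP.
by rewrite /upval; case: ifP.
Qed.

(* The test functions are [1 / rho] for the continuity equation and [1 + 1 / e]
   for the internal energy; with the latter [p Phi = (gamma - 1) (e + 1)], whose
   jump is that of the pressure. *)
Lemma log_functional_ge (B : R) : (forall K, internal (U K) <= B) ->
  iface_int (fun s => mesh_size T `^ (alpha - 1) * sqnorm (jump uh s)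
     - (2 + (gamma - 1) * B) * `|unorm uh s|)
  <= vol_int (fun K => dr K / rho (U K))
     + vol_int (fun K => dinternal U dr dm dE K * (1 + (internal (U K))^-1)).
Proof.
move=> eB; have r0 K : 0 < rho (U K) by case: (admU K).
have e0 K : 0 < internal (U K) by case: (admU K).
have HC := hC (fun K => (rho (U K))^-1).
move/eqP: HC; rewrite subr_eq add0r => /eqP ->.
rewrite (internal_balance hT r0 hC hM hE) iface_intD.
apply: ler_sum => s _; rewrite ler_wpM2l ?(ltW (area_gt0 hT _)) //.
have [mu0 _] := hmu s (admU (inK s)) (admU (outK s)).
have := @dissipation_ge (fun K => 1 + (internal (U K))^-1) s.
move=> /(_ _) /wrap[K|hD]; first by rewrite lerDl invr_ge0 ltW.
(* Density and internal energy each cost one [|u.n|], hence the 2. The pressure work costs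
   [(gamma - 1) B |u.n|], since two values in []0, B]] differ by at most [B]. *)
have hr := upwind_log_ge (unorm uh s) (r0 (inK s)) (r0 (outK s)) mu0.
have he := upwind_log_ge (unorm uh s) (e0 (inK s)) (e0 (outK s)) mu0.
have hp : - ((gamma - 1) * B * `|unorm uh s|) <=
    jump (fun K => pres gamma (U K) * (1 + (internal (U K))^-1)) s
      * unorm uh s.
  have -> : jump (fun K => pres gamma (U K) * (1 + (internal (U K))^-1)) s
      = (gamma - 1) * (internal (U (outK s)) - internal (U (inK s))).
    by rewrite /jump /pres; field; rewrite !gt_eqF.
  have : `|(gamma - 1) * (internal (U (outK s)) - internal (U (inK s)))
      * unorm uh s| <= (gamma - 1) * B * `|unorm uh s|.
    rewrite !normrM ler_wpM2r // gtr0_norm ?subr_gt0 //.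
    rewrite ler_wpM2l ?subr_ge0 ?(ltW gamma_gt1) //.
    have := eB (inK s); have := eB (outK s); have := e0 (inK s).
    by have := e0 (outK s); rewrite ler_norml => *; lra.
  by rewrite ler_norml => /andP[].
have jE : jump (fun K => 1 + (internal (U K))^-1) s
  = (internal (U (outK s)))^-1 - (internal (U (inK s)))^-1.
  by rewrite /jump; ring.
rewrite jE; move: hr he hp hD; rewrite /Fh /Up /muh /avg /jump.
set X := _ * (_ - _); set Y := _ * (_ - _); set Z := _ * unorm _ _.
set D := dissipation _ _ _ _ _; set W := `|unorm _ _|.
set P := _ * sqnorm _; lra.
Qed.

End State.

(** [a] is the cost per unit bound on the velocity coordinates, and [c] the coefficient of
    [jump_sum] once [velocity_bound] is inserted and the faces are summed. The first summand pays
    for the mean velocity, the last one is the Young remainder of each face and coordinate. *)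
Definition log_rate_bound (m1 M0 B : R) : R :=
  let a := (2 + (gamma - 1) * B) * N%:R in
  let A := \sum_(s : iface T) area (inl s) in
  let c := A * a * n in
  A * a * ((\sum_L vol (T := T) L) * m1 / M0)
  + \sum_(s : iface T) \sum_(i < N)
      c ^+ 2 / (4 * (area (inl s) * mesh_size T `^ (alpha - 1))).

(* Young: [- c x <= k x^2 + c^2 / (4 k)]. *)
Lemma log_rate_ge (U : Qh T (cstate R N)) (dr : Qh T R) (dm : Qh T 'rV[R]_N)
    (dE : Qh T R) (m1 M0 B : R) :
  (forall K, admissible (U K)) ->
  continuity_eq mu U dr -> momentum_eq gamma alpha mu U dm ->
  energy_eq gamma alpha mu U dE ->
  0 < M0 -> (forall K, M0 <= vol_int (fun L => rho (U L) * component K L)) ->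
  (forall K i, `|mom (U K) ord0 i| <= m1) ->
  0 <= B -> (forall K, internal (U K) <= B) ->
  - log_rate_bound m1 M0 B
  <= vol_int (fun K => dr K / rho (U K))
     + vol_int (fun K => dinternal U dr dm dE K * (1 + (internal (U K))^-1)).
Proof.
move=> admU hC hM hE M00 M0M mm B0 eB.
apply: le_trans (log_functional_ge admU hC hM hE eB).
have r0 K : 0 < rho (U K) by case: (admU K).
set u := fun K => vel (U K).
set V := (\sum_L vol (T := T) L) * m1 / M0.
have k_gt0 : 0 < mesh_size T `^ (alpha - 1).
  by rewrite powR_gt0 // (mesh_size_gt0 hT).
set k := mesh_size T `^ (alpha - 1) in k_gt0 *.
have uV K i : `|u K ord0 i| <= n * jump_sum u + V.
  exact: velocity_bound.
(* The coordinates of a unit normal are at most 1 in absolute value, so each of the [N] products is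
   bounded by the velocity coordinate alone. *)
have wV s : `|unorm u s| <= N%:R * (n * jump_sum u + V).
  apply: (@le_trans _ _ (\sum_(i < N) (n * jump_sum u + V))); last first.
    by rewrite sumr_const card_ord -[leLHS]mulr_natl.
  rewrite /unorm /dot (le_trans (ler_norm_sum _ _ _)) //.
  apply: ler_sum => i _; rewrite normrM -[leRHS]mulr1 ler_pM //.
    rewrite /avgv !mxE normrM gtr0_norm ?invr_gt0 // ler_pdivrMl //.
    rewrite (le_trans (ler_normD _ _)) // (natrD _ 1 1) mulrDl mul1r.
    have := uV (inK s) i; have := uV (outK s) i; rewrite /u /vel !mxE => *.
    exact: lerD.
  rewrite -(@ler_pXn2r _ 2) ?nnegrE // expr1n real_normK ?num_real //.
  by rewrite -(normal_unit hT (inl s)) sqr_coord_le.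
have area0 s : 0 < area (T := T) (inl s) := area_gt0 hT _.
set c0 := 2 + (gamma - 1) * B.
have c0_ge0 : 0 <= c0.
  by rewrite addr_ge0 // mulr_ge0 // subr_ge0 ltW.
set A := \sum_(s : iface T) area (inl s).
pose c := A * (c0 * N%:R) * n.
have young s (x : R) : - (c ^+ 2 / (4 * (area (T := T) (inl s) * k)))
    <= area (inl s) * k * x ^+ 2 - c * x.
  have ak : 0 < area (T := T) (inl s) * k by rewrite mulr_gt0.
  rewrite -subr_ge0 (_ : _ - _ =
    (2 * (area (inl s) * k) * x - c) ^+ 2 / (4 * (area (inl s) * k))).
    by rewrite divr_ge0 ?sqr_ge0 // ltW // mulr_gt0.
  by field; rewrite !gt_eqF.
(* [jump_sum] runs over the same faces and coordinates as the quadratic gain, so the loss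
   [c * jump_sum] is distributed term by term and each term is absorbed by Young. *)
apply: (@le_trans _ _ (\sum_(s : iface T) \sum_(i < N)
    (area (inl s) * k * `|jump u s ord0 i| ^+ 2 - c * `|jump u s ord0 i|)
    - A * (c0 * N%:R) * V)).
  rewrite /log_rate_bound -/A -/c0 -/k -/c -/V opprD addrC lerD2r.
  rewrite -sumrN; apply: ler_sum => s _.
  by rewrite -sumrN; apply: ler_sum => i _.
apply: (@le_trans _ _ (\sum_(s : iface T) area (inl s) *
    (k * sqnorm (jump u s) - c0 * (N%:R * (n * jump_sum u + V))))); last first.
  apply: ler_sum => s _; rewrite ler_wpM2l ?(ltW (area0 s)) // lerD2l lerN2.
  exact: ler_wpM2l.
rewrite le_eqVlt; apply/orP; left; apply/eqP.
rewrite [RHS](eq_bigr (fun s : iface T => area (inl s) * (k * sqnorm (jump u s))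
  - area (inl s) * (c0 * (N%:R * (n * jump_sum u + V))))); last first.
  by move=> s _; rewrite mulrBr.
rewrite [RHS]sumrB -mulr_suml -/A.
rewrite (eq_bigr (fun s : iface T => area (inl s) * (k * sqnorm (jump u s))
  - c * \sum_(i < N) `|jump u s ord0 i|)); last first.
  move=> s _; rewrite sumrB -!mulr_sumr; congr (_ - _).
  rewrite mulrA; congr (_ * _); apply: eq_bigr => i _.
  by rewrite real_normK ?num_real // expr2.
rewrite sumrB -mulr_sumr -/(jump_sum u) /c; ring.
Qed.

End EntropyProductionBound.

(** * Conservation laws and uniform bounds on a bounded time interval *)

Section APrioriBounds.
Set Implicit Arguments.
Unset Strict Implicit.
Variables (R : realType) (N : nat) (T : mesh_data R N) (gamma alpha : R).
Variables (mu : iface T -> cstate R N -> cstate R N -> R).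
Implicit Type U : R -> Qh T (cstate R N).

Definition rate_rho U t : Qh T R := fun K => derive1 (fun x => rho (U x K)) t.
Definition rate_mom U t : Qh T 'rV[R]_N :=
  fun K => \row_i derive1 (fun x => mom (U x K) ord0 i) t.
Definition rate_ene U t : Qh T R := fun K => derive1 (fun x => ene (U x K)) t.

Lemma solves_derive U tmax t : solves gamma alpha mu U tmax -> 0 <= t ->
  (t%:E < tmax)%E ->
  [/\ forall K, is_derive t 1 (fun x => rho (U x K)) (rate_rho U t K),
      forall K i, is_derive t 1 (fun x => mom (U x K) ord0 i)
                    (rate_mom U t K ord0 i) &
      forall K, is_derive t 1 (fun x => ene (U x K)) (rate_ene U t K)].
Proof.
move=> sU t0 tt; have [[hr hm hE] _] := sU t t0 tt.
split=> [K|K i|K]; rewrite ?mxE; exact: derivable_is_derive.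
Qed.

Lemma vol_int_is_derive (f : elem T -> R -> R) (df Phi : Qh T R) (t : R) :
  (forall K, is_derive t 1 (f K) (df K)) ->
  is_derive t 1 (fun x => vol_int (fun K => f K x * Phi K))
    (vol_int (fun K => df K * Phi K)).
Proof.
move=> fdf; apply: is_derive_bigsum => K; apply: is_derive_scale.
rewrite mulrC; under eq_fun do rewrite mulrC.
exact: is_derive_scale.
Qed.

Lemma vol_int_ge_term (f : Qh T R) K : regular_mesh T -> (forall L, 0 <= f L) ->
  vol K * f K <= vol_int f.
Proof.
move=> hT f0; rewrite /vol_int (bigD1 K) //= lerDl sumr_ge0 // => L _.
by rewrite mulr_ge0 // ltW // vol_gt0.
Qed.

(** One constant dominating every [(vol K)^-1], which turns a bound on an integral of a nonnegative
    function into a bound on each cell. *)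
Definition inv_vol_sum : R := \sum_(K : elem T) (vol K)^-1.

Lemma le_inv_vol_sum (x y : R) (K : elem T) : regular_mesh T -> 0 <= y ->
  vol K * x <= y -> x <= y * inv_vol_sum.
Proof.
move=> hT y0; rewrite -ler_pdivlMl ?vol_gt0 // mulrC => /le_trans; apply.
rewrite ler_wpM2l // /inv_vol_sum (bigD1 K) //= lerDl sumr_ge0 // => L _.
by rewrite invr_ge0 ltW // vol_gt0.
Qed.

Section Trajectory.
Variables (U : R -> Qh T (cstate R N)) (tm : R).
Hypothesis hT : regular_mesh T.
Hypothesis gamma_gt1 : 1 < gamma.
Hypothesis hmu : viscosity_ok mu.
Hypothesis tm0 : 0 < tm.
Hypothesis sU : solves gamma alpha mu U tm%:E.
Hypothesis aU : admissible_on U tm%:E.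

Let lte_fin_of (x : R) : x < tm -> (x%:E < tm%:E)%E.
Proof. by rewrite lte_fin. Qed.

Lemma constant_on (f df : R -> R) t : 0 <= t -> t < tm ->
  (forall x, 0 <= x -> x < tm -> is_derive x 1 f (df x)) ->
  (forall x, 0 <= x -> x < tm -> df x = 0) -> f t = f 0.
Proof.
move=> t0 tt fdf df0; apply/eqP; rewrite -subr_eq0 -normr_le0.
have := @MVT_norm_le R f df 0 t 0 t0; rewrite mul0r; apply=> x /andP[x0 xt].
  by apply: fdf => //; apply: le_lt_trans tt.
by rewrite df0 ?normr0 ?(ltW x0) // (lt_trans xt).
Qed.

Lemma mass_conserved (Phi : Qh T R) t : 0 <= t -> t < tm ->
  (forall s, jump Phi s = 0) ->
  vol_int (fun K => rho (U t K) * Phi K) = vol_int (fun K => rho (U 0 K) * Phi K).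
Proof.
move=> t0 tt jP.
apply: (@constant_on (fun t => vol_int (fun K => rho (U t K) * Phi K))
  (fun t => vol_int (fun K => rate_rho U t K * Phi K))) => // x x0 xt.
  apply: (vol_int_is_derive (f := fun K x => rho (U x K))).
  by have [] := solves_derive sU x0 (lte_fin_of xt).
have [_ [hC _ _]] := sU x0 (lte_fin_of xt).
have := hC Phi; rewrite [iface_int _]big1 ?subr0 // => s _.
by rewrite jP !mulr0.
Qed.

(** For the test function 1 every flux is multiplied by a zero jump, except the two pressure terms,
    which cancel on each face. *)
Lemma energy_conserved t : 0 <= t -> t < tm ->
  vol_int (fun K => ene (U t K)) = vol_int (fun K => ene (U 0 K)).
Proof.
move=> t0 tt.
suff : vol_int (fun K => ene (U t K) * 1) = vol_int (fun K => ene (U 0 K) * 1).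
  by rewrite /vol_int; under eq_bigr do rewrite mulr1;
     under [in RHS]eq_bigr do rewrite mulr1.
apply: (@constant_on (fun t => vol_int (fun K => ene (U t K) * 1))
  (fun t => vol_int (fun K => rate_ene U t K * 1))) => // x x0 xt.
  apply: (vol_int_is_derive (f := fun K x => ene (U x K)) (fun=> 1)).
  by have [] := solves_derive sU x0 (lte_fin_of xt).
have [_ [_ _ hE]] := sU x0 (lte_fin_of xt).
move: (hE (fun=> 1)); rewrite iface_intZ !(iface_intN, iface_intD).
rewrite -addrA -addrA !iface_intD.
move/eqP; rewrite -subr_eq0 iface_intN -addrA iface_intD => /eqP <-.
rewrite [iface_int _]big1 ?addr0 // => s _.
rewrite (_ : _ - _ = 0) ?mulr0 // /jump /avg !scale1r !mulr1 subrr; ring.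
Qed.

Lemma a_priori_bounds : exists b B : R, 0 < b /\
  forall t, 0 <= t -> t < tm -> forall K,
  [/\ b <= rho (U t K), b <= internal (U t K), rho (U t K) <= B,
      (forall i, `|mom (U t K) ord0 i| <= B) & `|ene (U t K)| <= B].
Proof.
have adm t : 0 <= t -> t < tm -> forall K, admissible (U t K).
  by move=> t0 tt; apply: aU; rewrite ?lte_fin.
have kin_ge0 w : admissible w -> 0 <= 2^-1 * (@sqnorm R N (mom w) / rho w).
  by case=> r0 _; rewrite mulr_ge0 ?divr_ge0 ?sqnorm_ge0 ?(ltW r0).
have int_le_ene w : admissible w -> internal w <= @ene R N w.
  by move=> aw; rewrite /internal lerBlDr lerDl kin_ge0.
have ene_gt0 w : admissible w -> 0 < @ene R N w.
  by move=> aw; apply: lt_le_trans (int_le_ene _ aw); case: aw.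
pose rho1 := vol_int (fun K => rho (U 0 K)) * inv_vol_sum.
have rho_le t K : 0 <= t -> t < tm -> rho (U t K) <= rho1.
  move=> t0 tt; have M0 L x : 0 <= x -> x < tm -> 0 <= rho (U x L).
    by move=> x0 xt; case: (adm x x0 xt L) => /ltW.
  have H : vol_int (fun K => rho (U t K)) = vol_int (fun K => rho (U 0 K)).
    have := @mass_conserved (fun=> 1) t t0 tt (fun s => subrr 1).
    by rewrite /vol_int; under eq_bigr do rewrite mulr1;
       under [in X in _ = X -> _]eq_bigr do rewrite mulr1.
  apply: (le_inv_vol_sum (K := K)) => //.
    by apply: sumr_ge0 => L _; rewrite mulr_ge0 ?M0 // ltW // vol_gt0.
  by rewrite -H; apply: vol_int_ge_term => // L; exact: M0.
pose ene1 := vol_int (fun K => ene (U 0 K)) * inv_vol_sum.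
have ene_le t K : 0 <= t -> t < tm -> ene (U t K) <= ene1.
  move=> t0 tt; apply: (le_inv_vol_sum (K := K)) => //.
    apply: sumr_ge0 => L _; rewrite mulr_ge0 ?ltW ?vol_gt0 //.
    by apply: ene_gt0; exact: adm.
  rewrite -(energy_conserved t0 tt); apply: vol_int_ge_term => // L.
  by rewrite ltW // ene_gt0 //; exact: adm.
have rho1_ge0 : 0 <= rho1.
  rewrite mulr_ge0 // sumr_ge0 // => K _.
    rewrite mulr_ge0 ?ltW ?vol_gt0 //.
    by have [] := adm 0 (lexx 0) tm0 K.
  by rewrite invr_ge0 ltW // vol_gt0.
have ene1_ge0 : 0 <= ene1.
  rewrite mulr_ge0 // sumr_ge0 // => K _.
    by rewrite mulr_ge0 ?ltW ?vol_gt0 ?ene_gt0 //; exact: adm.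
  by rewrite invr_ge0 ltW // vol_gt0.
clearbody rho1 ene1.
(* Positive internal energy gives [|m|^2 <= 2 rho E], and [x^2 <= a] implies [|x| <= 1 + a], which
   avoids a square root. *)
pose m1 := 1 + 2 * rho1 * ene1.
have mom_le t K i : 0 <= t -> t < tm -> `|mom (U t K) ord0 i| <= m1.
  move=> t0 tt; have [r0 i0] := adm t t0 tt K.
  set x := mom _ _ _; have xle : x ^+ 2 <= 2 * rho1 * ene1.
    apply: le_trans (sqr_coord_le _ _) _.
    have : sqnorm (mom (U t K)) <= 2 * rho (U t K) * ene (U t K).
      move: i0; rewrite /internal subr_gt0 mulrA ltr_pdivrMr // => /ltW.
      by set q := sqnorm _; set r := rho _; set e := ene _; lra.
    move=> /le_trans; apply; rewrite -!mulrA ler_wpM2l // ler_pM //.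
    - exact: ltW.
    - by apply: ltW; apply: ene_gt0; exact: adm.
    - exact: rho_le.
    - exact: ene_le.
  rewrite ler_norml; apply/andP; split; rewrite /m1; nra.
pose M K := vol_int (fun L => rho (U 0 L) * component K L).
have M_gt0 K : 0 < M K.
  apply: (@lt_le_trans _ _ (vol K * (rho (U 0 K) * component K K))).
    rewrite /component connect0 mulr1 mulr_gt0 ?vol_gt0 //.
    by have [] := adm 0 (lexx 0) tm0 K.
  apply: (@vol_int_ge_term (fun L => rho (U 0 L) * component K L)) => // L.
  rewrite mulr_ge0 //.
  by have [/ltW] := adm 0 (lexx 0) tm0 L.
(* A positive lower bound for all component masses; the summand 1 keeps the denominator positive
   whatever the sum. *)
pose M0 := (1 + \sum_K (M K)^-1)^-1.
have S0 : 0 < 1 + \sum_K (M K)^-1.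
  by rewrite ltr_wpDr // sumr_ge0 // => K _; rewrite invr_ge0 ltW.
have M0_gt0 : 0 < M0 by rewrite invr_gt0.
have M0_le K : M0 <= M K.
  rewrite /M0 -[leRHS]invrK lef_pV2 ?posrE ?invr_gt0 //.
  rewrite (bigD1 K) //= addrCA lerDl addr_ge0 // sumr_ge0 // => L _.
  by rewrite invr_ge0 ltW.
pose G t := vol_int (fun K => ln (rho (U t K)) * 1)
  + vol_int (fun K => (internal (U t K) + ln (internal (U t K))) * 1).
pose C := log_rate_bound T gamma alpha m1 M0 ene1.
(* With the absolute value, [t] can be replaced by [tm] whatever the sign of [C]. *)
have G_ge t : 0 <= t -> t < tm -> G 0 - `|C| * tm <= G t.
  move=> t0 tt.
  pose dG t := vol_int (fun K => rate_rho U t K / rho (U t K) * 1)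
    + vol_int (fun K => (dinternal (U t) (rate_rho U t) (rate_mom U t)
       (rate_ene U t) K * (1 + (internal (U t K))^-1)) * 1).
  have Gder x : 0 <= x <= t -> is_derive x 1 G (dG x).
    case/andP=> x0 xt; have {}xt := le_lt_trans xt tt.
    have [hr hm hE] := solves_derive sU x0 (lte_fin_of xt).
    apply: is_derive_add.
      apply: (vol_int_is_derive (f := fun K x => ln (rho (U x K)))
        (fun=> 1)) => K.
      by apply: is_derive_ln (hr K); case: (adm x x0 xt K).
    apply: (vol_int_is_derive
      (f := fun K x => internal (U x K) + ln (internal (U x K))) (fun=> 1)) => K.
    have [r0 i0] := adm x x0 xt K.
    have di := is_derive_internal r0 (hr K) (hm K) (hE K).
    rewrite mulrDr mulr1; apply: is_derive_add => //.
    exact: is_derive_ln.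
  have dG_ge x : 0 < x < t -> - `|C| <= dG x.
    case/andP=> x0 xt; have {}xt := lt_trans xt tt; have {}x0 := ltW x0.
    have [_ [hC hM hE]] := sU x0 (lte_fin_of xt).
    apply: (@le_trans _ _ (- C)); first by rewrite lerN2 ler_norm.
    rewrite /dG /vol_int; under eq_bigr do rewrite mulr1.
    under [X in _ + X]eq_bigr do rewrite mulr1.
    apply: (log_rate_ge hT gamma_gt1 hmu _ hC hM hE) => // [K|K|K i|K].
    - exact: adm.
    - by rewrite (mass_conserved x0 xt (@jump_component _ _ _ K)); exact: M0_le.
    - exact: mom_le.
    - by apply: le_trans (int_le_ene _ (adm x x0 xt K)) _; exact: ene_le.
  have := MVT_ge t0 Gder dG_ge; rewrite subr0 mulNr.
  have : `|C| * t <= `|C| * tm by rewrite ler_wpM2l // ltW.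
  by move: (`|C| * t) (`|C| * tm) => *; lra.
(* As [ln x < x], [Y] dominates the integrand of [G]. The deficit [f] is then nonnegative with
   bounded integral, hence at most [Z] on each cell, and since the other terms are bounded above,
   each logarithm is at least [- Z]. *)
pose Y := rho1 + 2 * ene1.
pose G1 := G 0 - `|C| * tm - (\sum_K vol (T := T) K) * Y.
pose Z := `|G1| * inv_vol_sum.
have low t K : 0 <= t -> t < tm ->
    expR (- Z) <= rho (U t K) /\ expR (- Z) <= internal (U t K).
  move=> t0 tt.
  pose f L := Y - ln (rho (U t L)) - internal (U t L) - ln (internal (U t L)).
  have bnd L : [/\ 0 < rho (U t L), 0 < internal (U t L),
      ln (rho (U t L)) <= rho1, internal (U t L) <= ene1 &
      ln (internal (U t L)) <= ene1].
    have aL := adm t t0 tt L; have [r0 i0] := aL.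
    have ie : internal (U t L) <= ene1.
      by apply: le_trans (int_le_ene _ aL) _; exact: ene_le.
    split=> //; first by apply: le_trans (ltW (ln_sublinear r0)) _; exact: rho_le.
    exact: le_trans (ltW (ln_sublinear i0)) ie.
  have f0 L : 0 <= f L by rewrite /f /Y; case: (bnd L) => *; lra.
  have fG : vol_int f = (\sum_K vol (T := T) K) * Y - G t.
    rewrite /G mulr_suml /vol_int opprD -!sumrN -!big_split /=.
    by apply: eq_bigr => L _; rewrite /f; ring.
  have fZ L : f L <= Z.
    apply: (le_inv_vol_sum (K := L)) => //.
    apply: le_trans (vol_int_ge_term L hT f0) _; rewrite fG.
    have := G_ge t t0 tt; have := ler_norm (- G1); rewrite normrN /G1.
    by move: (`|C| * tm) (_ * Y) => a c *; lra.
  have := fZ K; rewrite /f /Y; case: (bnd K) => r0 i0 lr i1 li fK.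
  rewrite -(lnK r0) -(lnK i0) !ler_expR; split; lra.
exists (expR (- Z)), (rho1 + ene1 + m1); split; first exact: expR_gt0.
have m1_ge0 : 0 <= m1 by rewrite addr_ge0 // !mulr_ge0.
move=> t t0 tt K; have [lr li] := low t K t0 tt.
have rl := rho_le t K t0 tt; have el := ene_le t K t0 tt.
split=> // [|i|].
- by apply: le_trans rl _; rewrite -addrA lerDl addr_ge0.
- by apply: le_trans (mom_le t K i t0 tt) _; rewrite lerDr addr_ge0.
rewrite ger0_norm; last by rewrite ltW // ene_gt0 //; exact: adm.
by apply: le_trans el _; lra.
Qed.

End Trajectory.
End APrioriBounds.

(** * Continuation of solutions *)

Section ExplicitRates.
Set Implicit Arguments.
Unset Strict Implicit.
Variables (R : realType) (N : nat) (T : mesh_data R N) (gamma alpha : R).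
Variables (mu : iface T -> cstate R N -> cstate R N -> R).
Hypothesis hT : regular_mesh T.
Implicit Type U : Qh T (cstate R N).

Local Notation "1_ K" := (fun L : elem T => (L == K)%:R : R) (at level 8).
Local Notation hdiff := (mesh_size T `^ (alpha - 1)).

(** Testing with the indicator of one cell isolates its time derivative. The three [rhs] functions
    are the right-hand side of the resulting autonomous ODE, a function of the state alone. *)
Definition rhs_rho U K : R := (vol K)^-1 *
  iface_int (fun s => Fh mu U (fun K => rho (U K)) s * jump 1_K s).

Definition rhs_mom U K (i : 'I_N) : R :=
  let Phi L : 'rV[R]_N := 1_K L *: delta_mx ord0 i in (vol K)^-1 *
  (- hdiff * iface_int (fun s => dot (jump (fun K => vel (U K)) s) (jump Phi s))
   - bface_int (fun b => pres gamma (U (ownK b))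
       * dot (face_normal (inr b)) (Phi (ownK b)))
   + iface_int (fun s => avg (fun K => pres gamma (U K)) s
       * dot (nrm s) (jump Phi s))
   + iface_int (fun s => dot (Fhv mu U (fun K => mom (U K)) s) (jump Phi s))).

Definition rhs_ene U K : R := (vol K)^-1 *
  (- hdiff * iface_int (fun s => dot (jump (fun K => vel (U K)) s)
       (avgv (fun K => vel (U K)) s) * jump 1_K s)
   - iface_int (fun s => avg (fun L => pres gamma (U L) * 1_K L) s
       * dot (jump (fun K => vel (U K)) s) (nrm s))
   + iface_int (fun s => avg (fun K => pres gamma (U K)) s
       * dot (jump (fun L => 1_K L *: vel (U L)) s) (nrm s))
   + iface_int (fun s => Fh mu U (fun K => ene (U K)) s * jump 1_K s)).

Lemma vol_int_indicator (d : Qh T R) K :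
  vol_int (fun L => d L * 1_K L) = vol K * d K.
Proof.
rewrite /vol_int (bigD1 K) //= eqxx mulr1 big1 ?addr0 // => L /negbTE ->.
by rewrite !mulr0.
Qed.

Lemma continuity_eq_rhs U d K : continuity_eq mu U d -> d K = rhs_rho U K.
Proof.
move=> /(_ 1_K) /eqP; rewrite vol_int_indicator subr_eq add0r => /eqP volE.
by rewrite /rhs_rho -volE mulKf // gt_eqF // vol_gt0.
Qed.

Lemma momentum_eq_rhs U d K i : momentum_eq gamma alpha mu U d ->
  d K ord0 i = rhs_mom U K i.
Proof.
pose Phi L : 'rV[R]_N := 1_K L *: delta_mx ord0 i.
have dotP (v : 'rV[R]_N) L : dot v (Phi L) = v ord0 i * 1_K L.
  rewrite dotZr mulrC; congr (_ * _).
  rewrite /dot (bigD1 i) //= mxE !eqxx mulr1 big1 ?addr0 // => j /negbTE ji.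
  by rewrite mxE ji andbF mulr0.
move=> /(_ Phi); rewrite {1}/vol_int.
under eq_bigr do rewrite dotP.
rewrite -[\sum_K _]/(vol_int (fun L => d L ord0 i * 1_K L)).
rewrite (vol_int_indicator (fun L => d L ord0 i)).
have isolate (a b c e g : R) : a - b - c + e = g -> a = g - e + c + b.
  by move=> <-; ring.
move/isolate => volE.
by rewrite /rhs_mom -/Phi -volE mulKf // gt_eqF // vol_gt0.
Qed.

Lemma energy_eq_rhs U d K : energy_eq gamma alpha mu U d -> d K = rhs_ene U K.
Proof.
move=> /(_ 1_K); rewrite vol_int_indicator.
have isolate (a b c e g : R) : a - b - c + e = g -> a = g - e + c + b.
  by move=> <-; ring.
move/isolate => volE.
by rewrite /rhs_ene -volE mulKf // gt_eqF // vol_gt0.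
Qed.

End ExplicitRates.

(** * Continuity of the rates at admissible states *)

Section RateConvergence.
Set Implicit Arguments.
Unset Strict Implicit.
Variables (R : realType) (N : nat) (X : Type) (F : set_system X).
Context {FF : ProperFilter F}.

(** The filter is arbitrary because the limits are taken both along ultrafilters and from the left
    of a time. *)
Definition tends (f : X -> R) (a : R) : Prop := f x @[x --> F] --> a.
Definition vtends (f : X -> 'rV[R]_N) (a : 'rV[R]_N) : Prop :=
  forall i, tends (fun x => f x ord0 i) (a ord0 i).
Definition ctends (f : X -> cstate R N) (a : cstate R N) : Prop :=
  [/\ tends (fun x => rho (f x)) (rho a), vtends (fun x => mom (f x)) (mom a) &
      tends (fun x => ene (f x)) (ene a)].

Lemma tends_cst a : tends (fun=> a) a. Proof. exact: cvg_cst. Qed.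

Lemma tendsD f g a b : tends f a -> tends g b -> tends (fun x => f x + g x) (a + b).
Proof. exact: cvgD. Qed.

Lemma tendsN f a : tends f a -> tends (fun x => - f x) (- a).
Proof. exact: cvgN. Qed.

Lemma tendsM f g a b : tends f a -> tends g b -> tends (fun x => f x * g x) (a * b).
Proof. exact: cvgM. Qed.

Lemma tendsMl c f a : tends f a -> tends (fun x => c * f x) (c * a).
Proof. by apply: tendsM; exact: tends_cst. Qed.

Lemma tendsMr c f a : tends f a -> tends (fun x => f x * c) (a * c).
Proof. by move=> fa; apply: tendsM => //; exact: tends_cst. Qed.

Lemma tendsV f a : a != 0 -> tends f a -> tends (fun x => (f x)^-1) a^-1.
Proof. exact: cvgV. Qed.

Lemma tends_norm f a : tends f a -> tends (fun x => `|f x|) `|a|.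
Proof. exact: cvg_norm. Qed.

Lemma tends_sum (I : Type) (r : seq I) (f : I -> X -> R) (a : I -> R) :
  (forall i, tends (f i) (a i)) ->
  tends (fun x => \sum_(i <- r) f i x) (\sum_(i <- r) a i).
Proof.
move=> fa; elim: r => [|i r IH].
  rewrite big_nil; under eq_fun do rewrite big_nil; exact: tends_cst.
by rewrite big_cons; under eq_fun do rewrite big_cons; exact: tendsD.
Qed.

Lemma vtends_cst a : vtends (fun=> a) a. Proof. by move=> i; exact: tends_cst. Qed.

Lemma vtendsD f g a b : vtends f a -> vtends g b ->
  vtends (fun x => f x + g x) (a + b).
Proof.
by move=> fa gb i; rewrite mxE; under eq_fun do rewrite mxE; exact: tendsD.
Qed.

Lemma vtendsN f a : vtends f a -> vtends (fun x => - f x) (- a).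
Proof.
by move=> fa i; rewrite mxE; under eq_fun do rewrite mxE; exact: tendsN.
Qed.

Lemma vtendsZ c f k a : tends c k -> vtends f a ->
  vtends (fun x => c x *: f x) (k *: a).
Proof.
by move=> ck fa i; rewrite mxE; under eq_fun do rewrite mxE; exact: tendsM.
Qed.

Lemma vtendsZl c f a : vtends f a -> vtends (fun x => c *: f x) (c *: a).
Proof. by apply: vtendsZ; exact: tends_cst. Qed.

Lemma tends_dot f g a b : vtends f a -> vtends g b ->
  tends (fun x => dot (f x) (g x)) (dot a b).
Proof. by move=> fa gb; apply: tends_sum => i; exact: tendsM. Qed.

Lemma tends_dotr f a v : vtends f a -> tends (fun x => dot (f x) v) (dot a v).
Proof. by move=> fa; apply: tends_dot => //; exact: vtends_cst. Qed.

Lemma tends_internal f a : 0 < rho a -> ctends f a ->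
  tends (fun x => internal (f x)) (internal a).
Proof.
move=> a0 [fr fm fe]; apply: tendsD => //; apply: tendsN; apply: tendsMl.
by apply: tendsM; [exact: tends_dot | apply: tendsV; rewrite ?gt_eqF].
Qed.

Lemma tends_pres gamma f a : 0 < rho a -> ctends f a ->
  tends (fun x => pres gamma (f x)) (pres gamma a).
Proof.
by move=> a0 fa; apply: tendsMl; exact: tends_internal.
Qed.

Lemma vtends_vel f a : 0 < rho a -> ctends f a ->
  vtends (fun x => vel (f x)) (vel a).
Proof. by move=> a0 [fr fm _]; apply: vtendsZ => //; apply: tendsV; rewrite ?gt_eqF. Qed.

(** Continuity of the viscosity refers to the product topology on states; coordinatewise limits of
    the momentum combine because there are finitely many coordinates. *)
Lemma ctends_cvg f a : ctends f a -> f x @[x --> F] --> a.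
Proof.
case: a => -[ar am] ae [fr fm fe].
rewrite (_ : f = fun x => ((rho (f x), mom (f x)), ene (f x))); last first.
  by apply/funext => x; case: (f x) => -[].
have fm' : mom (f x) @[x --> F] --> am; last first.
  have frm : (rho (f x), mom (f x)) @[x --> F] --> (ar, am).
    exact: (cvg_pair fr fm').
  exact: (cvg_pair frm fe).
move=> A [P Pam PA]; rewrite /nbhs /=.
have : \forall x \near F, forall ij : 'I_1 * 'I_N,
    P ij.1 ij.2 (mom (f x) ij.1 ij.2).
  apply: filter_forall => -[i j] /=; rewrite ord1; apply: (fm j).
  by have := Pam ord0 j.
by apply: filterS => x Px; apply: PA => i j; exact: (Px (i, j)).
Qed.

Variables (T : mesh_data R N) (gamma alpha : R).
Variables (mu : iface T -> cstate R N -> cstate R N -> R).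
Hypothesis hmu : viscosity_ok mu.
Variables (V : X -> Qh T (cstate R N)) (W : Qh T (cstate R N)).
Hypothesis admW : forall K, admissible (W K).
Hypothesis VW : forall K, ctends (fun x => V x K) (W K).

Let rho0 K : 0 < rho (W K). Proof. by case: (admW K). Qed.

Lemma tends_muh s : tends (fun x => muh mu (V x) s) (muh mu W s).
Proof.
have [_ mc] := hmu s (admW (inK s)) (admW (outK s)).
have Vs : (V x (inK s), V x (outK s)) @[x --> F] --> (W (inK s), W (outK s)).
  exact: (cvg_pair (ctends_cvg (VW _)) (ctends_cvg (VW _))).
exact: (cvg_comp _ _ Vs mc).
Qed.

Lemma tends_iface_int (f : X -> iface T -> R) a :
  (forall s, tends (fun x => f x s) (a s)) ->
  tends (fun x => iface_int (f x)) (iface_int a).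
Proof. by move=> fa; apply: tends_sum => s; apply: tendsMl. Qed.

Let vW K : vtends (fun x => vel (V x K)) (vel (W K)).
Proof. exact: vtends_vel. Qed.

Let mW K : vtends (fun x => mom (V x K)) (mom (W K)).
Proof. by case: (VW K). Qed.

Let pW K : tends (fun x => pres gamma (V x K)) (pres gamma (W K)).
Proof. exact: tends_pres. Qed.

Lemma tends_unorm s :
  tends (fun x => unorm (fun K => vel (V x K)) s) (unorm (fun K => vel (W K)) s).
Proof.
apply: tends_dotr; apply: vtendsZl.
exact: vtendsD.
Qed.

Lemma tends_Fh (r : cstate R N -> R) s :
  (forall K, tends (fun x => r (V x K)) (r (W K))) ->
  tends (fun x => Fh mu (V x) (fun K => r (V x K)) s)
    (Fh mu W (fun K => r (W K)) s).
Proof.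
move=> rW; apply: tendsD; last first.
  apply: tendsN; apply: tendsM; first exact: tends_muh.
  by apply: tendsD => //; exact: tendsN.
apply: tendsD.
  by apply: tendsM; [apply: tendsMr; exact: tendsD | exact: tends_unorm].
apply: tendsN; apply: tendsM; last by apply: tendsD => //; exact: tendsN.
by apply: tendsMl; apply: tends_norm; exact: tends_unorm.
Qed.

Lemma vtends_Fhv s :
  vtends (fun x => Fhv mu (V x) (fun K => mom (V x K)) s)
    (Fhv mu W (fun K => mom (W K)) s).
Proof.
have jump_mom : vtends (fun x => jump (fun K => mom (V x K)) s)
    (jump (fun K => mom (W K)) s).
  by apply: vtendsD => //; exact: vtendsN.
apply: vtendsD; last by apply: vtendsN; apply: vtendsZ => //; exact: tends_muh.
apply: vtendsD.
  apply: vtendsZ; first exact: tends_unorm.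
  by apply: vtendsZl; exact: vtendsD.
apply: vtendsN; apply: vtendsZ => //.
by apply: tendsMl; apply: tends_norm; exact: tends_unorm.
Qed.

Let avg_pW s : tends (fun x => avg (fun K => pres gamma (V x K)) s)
  (avg (fun K => pres gamma (W K)) s).
Proof. by apply: tendsMr; exact: tendsD. Qed.

Let jump_vW s : vtends (fun x => jump (fun K => vel (V x K)) s)
  (jump (fun K => vel (W K)) s).
Proof. by apply: vtendsD => //; exact: vtendsN. Qed.

Lemma tends_rhs_rho K : tends (fun x => rhs_rho mu (V x) K) (rhs_rho mu W K).
Proof.
apply: tendsMl; apply: tends_iface_int => s.
apply: tendsMr; apply: tends_Fh => L; by case: (VW L).
Qed.

Lemma tends_rhs_mom K i :
  tends (fun x => rhs_mom gamma alpha mu (V x) K i) (rhs_mom gamma alpha mu W K i).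
Proof.
apply: tendsMl; apply: tendsD; first apply: tendsD; first apply: tendsD.
- apply: tendsMl; apply: tends_iface_int => s.
  exact: tends_dotr.
- apply: tendsN; apply: tends_sum => b; apply: tendsMl.
  exact: tendsMr.
- by apply: tends_iface_int => s; exact: tendsMr.
- by apply: tends_iface_int => s; apply: tends_dotr; exact: vtends_Fhv.
Qed.

Lemma tends_rhs_ene K :
  tends (fun x => rhs_ene gamma alpha mu (V x) K) (rhs_ene gamma alpha mu W K).
Proof.
apply: tendsMl; apply: tendsD; first apply: tendsD; first apply: tendsD.
- apply: tendsMl; apply: tends_iface_int => s.
  apply: tendsMr; apply: tends_dot => //.
  by apply: vtendsZl; exact: vtendsD.
- apply: tendsN; apply: tends_iface_int => s; apply: tendsM.
    by apply: tendsMr; apply: tendsD; exact: tendsMr.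
  exact: tends_dotr.
- apply: tends_iface_int => s; apply: tendsM => //.
  apply: tends_dotr; apply: vtendsD; last apply: vtendsN;
  exact: vtendsZl.
- apply: tends_iface_int => s; apply: tendsMr.
  by apply: tends_Fh => L; case: (VW L).
Qed.

End RateConvergence.

(** * Compactness through ultrafilters *)

Section UltraLimits.
Set Implicit Arguments.
Unset Strict Implicit.
Variables (R : realType) (X : Type).

(** The image filter clusters in the compact segment [[- B, B]], and a cluster point of an
    ultrafilter is a limit. *)
Lemma ultra_bounded_tends (G : set_system X) (f : X -> R) (B : R) :
  UltraFilter G -> (\forall x \near G, `|f x| <= B) -> exists l, tends G f l.
Proof.
move=> UG fB; have PG : ProperFilter G by exact: ultra_proper.
have PfG : ProperFilter (f x @[x --> G]) by exact: fmap_proper_filter.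
have [|l [_ cl]] := @segment_compact R (- B) B (f x @[x --> G]) PfG.
  by apply: filterS fB => x; rewrite /= in_itv /= -ler_norml.
exists l => A lA; have [//|GA] := in_ultra_setVsetC (f @^-1` A) UG.
have [y [/= nAy Ay]] : (~` A) `&` A !=set0 by apply: cl => //; exact: GA.
by [].
Qed.

(** If [g] were unbounded, the sets where [|g| > n] would lie in an ultrafilter, along which [g]
    could have no finite limit. This bounds the rates without estimating them term by term. *)
Lemma ultra_bounded (I : set X) (g : X -> R) :
  (forall G : set_system X, UltraFilter G -> G I -> exists l, tends G g l) ->
  exists M, forall x, I x -> `|g x| <= M.
Proof.
move=> gG; apply: contrapT => unb.
pose D (n : nat) := [set x | I x /\ n%:R < `|g x|].
have D0 n : D n !=set0.
  apply: contrapT => Dn; apply: unb; exists n%:R => x Ix.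
  by rewrite leNgt; apply/negP => gx; apply: Dn; exists x.
have FD : Filter (filter_from setT D).
  apply: filter_fromT_filter; first by exists 0%N.
  move=> i j; exists (maxn i j) => x [Ix gx]; split; split=> //;
  by apply: le_lt_trans gx; rewrite ler_nat ?leq_maxl ?leq_maxr.
have PD : ProperFilter (filter_from setT D) by apply: filter_from_proper => n _.
have [G [UG DG]] := ultraFilterLemma PD.
have GD n : G (D n) by apply: DG; exists n.
have PG : ProperFilter G by exact: ultra_proper.
have GI : G I by apply: filterS (GD 0%N) => x [].
have [l gl] := gG G UG GI.
have ln : tends G (fun x => `|g x|) `|l| by exact: tends_norm.
have le : \forall x \near G, `|g x| <= `|l| + 1.
  by apply: (cvgr_le _ ln); rewrite ltrDl.
have [n ln1] : exists n : nat, `|l| + 1 < n%:R.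
  by exists (Num.truncn (`|l| + 1)).+1; exact: truncnS_gt.
have [x [[_ nx] xl]] := filter_ex (filterI (GD n) le).
by have := lt_le_trans (lt_trans ln1 nx) xl; rewrite ltxx.
Qed.

End UltraLimits.

(** * Left limits and differentiability at a junction *)

Section Glue.
Set Implicit Arguments.
Unset Strict Implicit.
Variable R : realType.
Implicit Types (f g df : R -> R) (a d l M : R).

Lemma at_left_itv (a b : R) : b < a -> \forall x \near a^'-, b <= x < a.
Proof.
move=> ba; near=> x; apply/andP; split.
  by apply/ltW; near: x; exact: nbhs_left_gt.
by near: x; exact: nbhs_left_lt.
Unshelve. all: by end_near. Qed.

(* The Lipschitz bound passes to the limit in its second argument along the finer
   ultrafilter. *)
Lemma lipschitz_left_tends (G : set_system R) f df (b a l M : R) :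
  ProperFilter G -> a^'- `<=` G -> b < a ->
  (forall x, b <= x < a -> is_derive x 1 f (df x)) ->
  (forall x, b <= x < a -> `|df x| <= M) ->
  tends G f l -> tends (a^'-) f l.
Proof.
move=> PG aG ba fdf dfM fl.
have lip x y : b <= x < a -> b <= y < a -> `|f y - f x| <= M * `|y - x|.
  wlog xy : x y / x <= y => [wlg xb yb|].
    have [/wlg|/ltW/wlg] := leP x y; first exact.
    by rewrite distrC (distrC y); apply.
  move=> /andP[bx xa] /andP[b_y ya]; rewrite (ger0_norm (_ : 0 <= y - x)) ?subr_ge0 //.
  apply: (MVT_norm_le xy) => z /andP[xz zy].
    by apply: fdf; rewrite (le_trans bx) //= (le_lt_trans zy).
  by apply: dfM; rewrite (le_trans bx) ?(ltW xz) //= (lt_trans zy).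
have lipl x : b <= x < a -> `|l - f x| <= M * `|a - x|.
  move=> xb.
  have t1 : tends G (fun y => `|f y - f x|) `|l - f x|.
    by apply: tends_norm; apply: tendsD => //; exact: tends_cst.
  have Ga : tends G (fun y => y) a.
    by move=> A aA; apply: aG; exact: cvg_at_left_filter aA.
  have t2 : tends G (fun y => M * `|y - x|) (M * `|a - x|).
    by apply: tendsMl; apply: tends_norm; apply: tendsD => //; exact: tends_cst.
  rewrite -subr_ge0; apply: (cvgr_to_ge (tendsD t2 (tendsN t1))).
  apply: filterS (aG _ (at_left_itv ba)) => y yb.
  by rewrite subr_ge0; exact: lip.
apply/cvgrPdist_le => e e0.
have Ma : tends (a^'-) (fun x => M * `|a - x|) 0.
  have : tends (a^'-) (fun x => M * `|a - x|) (M * `|a - a|).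
    apply: tendsMl; apply: tends_norm; apply: tendsD; first exact: tends_cst.
    apply: tendsN; exact: cvg_at_left_filter.
  by rewrite subrr normr0 mulr0.
near=> x; apply: le_trans (lipl x _) _; first by near: x; exact: at_left_itv.
by near: x; exact: (cvgr_le _ Ma).
Unshelve. all: by end_near. Qed.

(** The right difference quotient is that of [g] at 0. For the left one, the derivative of [f - d x]
    is small near [a], so the mean value theorem, followed by a passage to the limit at [a], makes
    the quotient close to [d]. *)
Lemma glue_is_derive f df g (b a d : R) : b < a ->
  (forall x, b <= x < a -> is_derive x 1 f (df x)) ->
  tends (a^'-) f (g 0) -> tends (a^'-) df d -> is_derive (0 : R) (1 : R) g d ->
  is_derive a 1 (fun x => if x < a then f x else g (x - a)) d.
Proof.
move=> ba fdf fg dfd gd; set w := fun x => _.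
have wa : w a = g 0 by rewrite /w ltxx subrr.
have est e : 0 < e -> \forall x \near a^'-,
    `|f x - g 0 - d * (x - a)| <= e * (a - x).
  move=> e0.
  have /(cvgrPdist_le _ _) /(_ e e0) dfe := dfd.
  (* A single radius [r] then serves all times between [x] and [a], as the mean value theorem
     requires. *)
  have near_a : \forall x \near a, x < a ->
      (b <= x < a) /\ `|d - df x| <= e.
    exact: (filterI (at_left_itv ba) dfe).
  have [r /= r0 rP] := (nbhs_ballP a _).1 near_a.
  near=> x; have [xb xa xr] : [/\ b <= x, x < a & a - x < r].
    by split; [apply/ltW| |]; near: x;
      [exact: nbhs_left_gt | exact: nbhs_left_lt | exact: nbhs_left_ltBl].
  have P y : x <= y < a -> (b <= y < a) /\ `|d - df y| <= e.
    case/andP=> xy ya; apply: rP => //=; rewrite /ball /= gtr0_norm ?subr_gt0 //.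
    by apply: le_lt_trans xr; rewrite lerD2l lerN2.
  have incr y : x <= y < a ->
      `|(f y - d * y) - (f x - d * x)| <= e * (y - x).
    case/andP=> xy ya.
    apply: (@MVT_norm_le R (fun z => f z - d * z) (fun z => df z - d)) => //.
      move=> z /andP[xz zy].
      have [|/fdf fz _] := P z; first by rewrite xz (le_lt_trans zy).
      apply: is_deriveB => //; rewrite -[X in is_derive _ _ _ X]mulr1.
      by apply: is_derive_scale; exact: is_derive_id.
    move=> z /andP[xz zy]; rewrite distrC.
    by case: (P z _); rewrite ?(ltW xz) ?(lt_trans zy).
  have Ia : tends (a^'-) (fun y => y) a by exact: cvg_at_left_filter.
  have t1 : tends (a^'-) (fun y => `|(f y - d * y) - (f x - d * x)|)
      `|(g 0 - d * a) - (f x - d * x)|.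
    apply: tends_norm; apply: tendsD; last exact: tends_cst.
    by apply: tendsD => //; apply: tendsN; exact: tendsMl.
  have t2 : tends (a^'-) (fun y => e * (y - x)) (e * (a - x)).
    by apply: tendsMl; apply: tendsD => //; exact: tends_cst.
  rewrite distrC [X in `|X|](_ : _ = (g 0 - d * a) - (f x - d * x)); last by ring.
  rewrite -subr_ge0; apply: (cvgr_to_ge (tendsD t2 (tendsN t1))).
  near=> y; rewrite subr_ge0; apply: incr; near: y; exact: at_left_itv.
suff wd : (fun h : R => h^-1 *: ((w \o shift a) (h *: 1) - w a)) @ 0^' --> d.
  by split; [exact: cvgP wd | exact: cvg_lim wd].
apply: (@cvg_at_right_left_dnbhs _ R^o).
  have gd' : (fun h : R => h^-1 *: ((g \o shift 0) (h *: 1) - g 0)) @ 0^' --> d.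
    by case: gd => dg <-.
  apply: cvg_trans (cvg_dnbhs_at_right gd').
  apply: near_eq_cvg; near=> h.
  have h0 : 0 < h by near: h; exact: nbhs_right_gt.
  rewrite wa /w /= addr0 ltNge lerDr.
  by rewrite /GRing.scale /= mulr1 (ltW h0) addrK.
apply/cvgrPdist_le => e e0; apply/nbhs_left0P.
have /nbhs_left0P := est e e0; apply: filterS2 (nbhs_right_gt 0) => h h0.
rewrite wa sub0r /w /= /GRing.scale /= mulr1 (addrC (- h)) ltrBlDr ltrDl h0.
rewrite subKr => hest.
rewrite -(ler_pM2l h0) -{1}(gtr0_norm h0) -normrM mulrC (mulrC h e).
by apply: le_trans hest; rewrite le_eqVlt; apply/orP; left; apply/eqP;
   congr `|_|; field; rewrite gt_eqF.
Unshelve. all: by end_near. Qed.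

End Glue.

Section GluedFunction.
Set Implicit Arguments.
Unset Strict Implicit.
Variable R : realType.
Implicit Types (f g : R -> R) (a d t : R).

Lemma glue_is_derive_left f g a d t : t < a -> is_derive t 1 f d ->
  is_derive t 1 (fun x => if x < a then f x else g (x - a)) d.
Proof.
move=> ta; apply: near_eq_is_derive.
have tt : x @[x --> t] --> t by exact: cvg_id.
have : \forall x \near t, x < a by exact: (cvgr_lt t tt).
by apply: filterS => x ->.
Qed.

Lemma glue_is_derive_right f g a d t : a < t -> is_derive (t - a) 1 g d ->
  is_derive t 1 (fun x => if x < a then f x else g (x - a)) d.
Proof.
move=> ta gd; apply: (@near_eq_is_derive _ _ _ (fun x => g (x - a))).
  have tt : x @[x --> t] --> t by exact: cvg_id.
  have : \forall x \near t, a < x by exact: (cvgr_gt t tt).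
  by apply: filterS => x ax; rewrite ltNge (ltW ax).
have sd : is_derive t 1 (fun x => x - a) 1 by exact: is_derive_shift.
by have := @is_derive1_comp R g (fun x => x - a) t _ _ gd sd; rewrite mulr1.
Qed.

End GluedFunction.

(** * Restart at a finite time, global existence and uniqueness *)

Section GlobalSolution.
Set Implicit Arguments.
Unset Strict Implicit.
Variables (R : realType) (N : nat) (T : mesh_data R N) (gamma alpha : R).
Variables (mu : iface T -> cstate R N -> cstate R N -> R).
Hypothesis hT : regular_mesh T.
Hypothesis gamma_gt1 : 1 < gamma.
Hypothesis hmu : viscosity_ok mu.
Implicit Type U V : R -> Qh T (cstate R N).

Lemma cstate_ext (w w' : cstate R N) : rho w = rho w' ->
  (forall i, mom w ord0 i = mom w' ord0 i) -> ene w = ene w' -> w = w'.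
Proof.
case: w w' => [[r m] e] [[r' m'] e']; rewrite /rho /mom /ene /= => -> mm ->.
by congr (_, _, _); apply/rowP.
Qed.

Definition solves_at U t : Prop :=
  [/\ forall K, derivable (fun x : R => rho (U x K)) t 1,
      forall K i, derivable (fun x : R => mom (U x K) ord0 i) t 1 &
      forall K, derivable (fun x : R => ene (U x K)) t 1] /\
  [/\ continuity_eq mu (U t) (rate_rho U t),
      momentum_eq gamma alpha mu (U t) (rate_mom U t) &
      energy_eq gamma alpha mu (U t) (rate_ene U t)].

(** The scheme is autonomous: only the state and its derivative enter, so the equations carry over
    between different times. *)
Lemma solves_at_transfer U V t t' : solves_at V t' -> U t = V t' ->
  (forall K d, is_derive t' 1 (fun x => rho (V x K)) d ->
               is_derive t 1 (fun x => rho (U x K)) d) ->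
  (forall K i d, is_derive t' 1 (fun x => mom (V x K) ord0 i) d ->
               is_derive t 1 (fun x => mom (U x K) ord0 i) d) ->
  (forall K d, is_derive t' 1 (fun x => ene (V x K)) d ->
               is_derive t 1 (fun x => ene (U x K)) d) ->
  solves_at U t.
Proof.
move=> [[dr dm dE] [hC hM hE]] UV tr tm te.
have Hr K := tr K _ (derivable_is_derive (dr K)).
have Hm K i := tm K i _ (derivable_is_derive (dm K i)).
have He K := te K _ (derivable_is_derive (dE K)).
have rr : rate_rho U t = rate_rho V t'.
  by apply/funext => K; exact: is_derive_derive1.
have rm : rate_mom U t = rate_mom V t'.
  by apply/funext => K; apply/rowP => i; rewrite !mxE; exact: is_derive_derive1.
have re : rate_ene U t = rate_ene V t'.
  by apply/funext => K; exact: is_derive_derive1.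
split; first by split=> [K|K i|K]; [case: (Hr K)|case: (Hm K i)|case: (He K)].
by rewrite /= rr rm re UV.
Qed.

Lemma solves_rhs U tmax t : solves gamma alpha mu U tmax -> 0 <= t ->
  (t%:E < tmax)%E ->
  [/\ forall K, is_derive t 1 (fun x => rho (U x K)) (rhs_rho mu (U t) K),
      forall K i, is_derive t 1 (fun x => mom (U x K) ord0 i)
                    (rhs_mom gamma alpha mu (U t) K i) &
      forall K, is_derive t 1 (fun x => ene (U x K))
                    (rhs_ene gamma alpha mu (U t) K)].
Proof.
move=> sU t0 tt; have [hr hm hE] := solves_derive sU t0 tt.
have [_ [eC eM eE]] := sU t t0 tt.
split=> [K|K i|K].
- by rewrite -(continuity_eq_rhs hT K eC); exact: hr.
- by rewrite -(momentum_eq_rhs hT K i eM); exact: hm.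
- by rewrite -(energy_eq_rhs hT K eE); exact: hE.
Qed.

Section FiniteTime.
Variables (U : R -> Qh T (cstate R N)) (tm : R).
Hypothesis tm0 : 0 < tm.
Hypothesis sU : solves gamma alpha mu U tm%:E.
Hypothesis aU : admissible_on U tm%:E.

Let I : set R := [set t | 0 <= t < tm].

(** The a priori bounds make every component converge along [G]; the lower bounds on density and
    internal energy pass to the limit, which keeps it admissible. *)
Lemma ultra_limit_state (G : set_system R) : UltraFilter G -> G I ->
  exists W : Qh T (cstate R N), forall K,
    admissible (W K) /\ ctends G (fun t => U t K) (W K).
Proof.
move=> UG GI; have PG : ProperFilter G by exact: ultra_proper.
have [b [B [b0 bd]]] := a_priori_bounds hT gamma_gt1 hmu tm0 sU aU.
have nearI (P : R -> Prop) : (forall t, 0 <= t -> t < tm -> P t) ->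
    \forall t \near G, P t.
  by move=> IP; apply: filterS GI => t /andP[]; exact: IP.
have /choice[r rP] : forall K, exists l, tends G (fun t => rho (U t K)) l.
  move=> K; apply: (@ultra_bounded_tends _ _ _ _ B); apply: nearI => t t0 tt.
  have [br _ rB _ _] := bd t t0 tt K.
  by rewrite ger0_norm // (le_trans _ br) // ltW.
have /choice[m mP] : forall Ki : elem T * 'I_N, exists l,
    tends G (fun t => mom (U t Ki.1) ord0 Ki.2) l.
  move=> [K i] /=; apply: (@ultra_bounded_tends _ _ _ _ B).
  by apply: nearI => t t0 tt; have [_ _ _] := bd t t0 tt K.
have /choice[e eP] : forall K, exists l, tends G (fun t => ene (U t K)) l.
  move=> K; apply: (@ultra_bounded_tends _ _ _ _ B); apply: nearI => t t0 tt.
  by have [] := bd t t0 tt K.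
exists (fun K => (r K, \row_i m (K, i), e K)) => K.
have c : ctends G (fun t => U t K) (r K, \row_i m (K, i), e K).
  split; [exact: rP | | exact: eP].
  by move=> i; rewrite /mom /= mxE; exact: (mP (K, i)).
have r0 : b <= r K.
  by apply: (cvgr_to_ge (rP K)); apply: nearI => t t0 tt; have [] := bd t t0 tt K.
have {}r0 := lt_le_trans b0 r0.
split=> //; split=> //; apply: (lt_le_trans b0).
have ti : tends G (fun t => internal (U t K)) (internal (r K, \row_i m (K, i), e K)).
  exact: tends_internal.
apply: (cvgr_to_ge ti).
by apply: nearI => t t0 tt; have [] := bd t t0 tt K.
Qed.

(** The rates converge along every ultrafilter on the interval, hence are bounded; the state is
    therefore Lipschitz in time, and its limit along one ultrafilter finer than the left
    neighbourhoods is a genuine left limit. *)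
Lemma left_limit_state : exists W : Qh T (cstate R N), forall K,
  admissible (W K) /\ ctends (tm^'-) (fun t => U t K) (W K).
Proof.
have der t : 0 <= t < tm -> (0 <= t) * (t%:E < tm%:E)%E.
  by case/andP=> -> ?; rewrite lte_fin.
have bnd_rho K : exists M, forall t, I t -> `|rhs_rho mu (U t) K| <= M.
  apply: ultra_bounded => G UG GI; have [W WP] := ultra_limit_state UG GI.
  have PG : ProperFilter G by exact: ultra_proper.
  exists (rhs_rho mu W K); apply: tends_rhs_rho => // L; by case: (WP L).
have bnd_mom K i : exists M, forall t, I t ->
    `|rhs_mom gamma alpha mu (U t) K i| <= M.
  apply: ultra_bounded => G UG GI; have [W WP] := ultra_limit_state UG GI.
  have PG : ProperFilter G by exact: ultra_proper.
  exists (rhs_mom gamma alpha mu W K i).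
  by apply: tends_rhs_mom => // L; case: (WP L).
have bnd_ene K : exists M, forall t, I t ->
    `|rhs_ene gamma alpha mu (U t) K| <= M.
  apply: ultra_bounded => G UG GI; have [W WP] := ultra_limit_state UG GI.
  have PG : ProperFilter G by exact: ultra_proper.
  exists (rhs_ene gamma alpha mu W K).
  by apply: tends_rhs_ene => // L; case: (WP L).
have [G [UG tG]] := ultraFilterLemma (at_left_proper_filter tm).
have PG : ProperFilter G by exact: ultra_proper.
have GI : G I by apply: tG; exact: at_left_itv.
have [W WP] := ultra_limit_state UG GI.
exists W => K; have [aW [cr cm ce]] := WP K; split=> //; split.
- have [M HM] := bnd_rho K.
  apply: (lipschitz_left_tends PG tG tm0 _ HM cr) => t /der tI.
  by have [h _ _] := solves_rhs sU tI.1 tI.2.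
- move=> i; have [M HM] := bnd_mom K i.
  apply: (lipschitz_left_tends PG tG tm0 _ HM (cm i)) => t /der tI.
  by have [_ h _] := solves_rhs sU tI.1 tI.2.
- have [M HM] := bnd_ene K.
  apply: (lipschitz_left_tends PG tG tm0 _ HM ce) => t /der tI.
  by have [_ _ h] := solves_rhs sU tI.1 tI.2.
Qed.

Lemma solution_extends (hode : ode_wellposed gamma alpha mu) :
  exists (d : R) (V : R -> Qh T (cstate R N)),
    [/\ 0 < d, solves gamma alpha mu V (tm + d)%:E,
        admissible_on V (tm + d)%:E & V 0 = U 0].
Proof.
have [W WP] := left_limit_state.
have adW K : admissible (W K) by case: (WP K).
have cW K : ctends (tm^'-) (fun t => U t K) (W K) by case: (WP K).
have [tmax [U' [tmax0 sU' aU' U'0 _]]] := hode W adW.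
(* The restarted solution may be global; a finite piece of length 1 is then enough. *)
have [d d0 dt] : exists2 d : R, 0 < d & (d%:E <= tmax)%E.
  case: tmax tmax0 {sU' aU'} => [r r0| _|//]; first by exists r.
  by exists 1; rewrite ?leey.
pose V x := if x < tm then U x else U' (x - tm).
have VE (phi : cstate R N -> R) K : (fun x => phi (V x K)) =
    (fun x => if x < tm then phi (U x K) else phi (U' (x - tm) K)).
  by apply/funext => x; rewrite /V; case: ifP.
have der t : 0 <= t < tm -> (0 <= t) * (t%:E < tm%:E)%E.
  by case/andP=> -> ?; rewrite lte_fin.
exists d, V; split=> //; last by rewrite /V tm0.
- move=> t t0 tt; rewrite -/(solves_at V t).
  have [ttm|tmt|ttm] := ltgtP t tm.
  + have tI : 0 <= t < tm by rewrite t0.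
    apply: (@solves_at_transfer V U t t).
    * exact: (sU (der t tI).1 (der t tI).2).
    * by rewrite /V ttm.
    * move=> K x hx; rewrite (VE (@rho R N)).
      exact: (glue_is_derive_left (fun x => rho (U' x K)) ttm hx).
    * move=> K i x hx; rewrite (VE (fun w => mom w ord0 i)).
      exact: (glue_is_derive_left (fun x => mom (U' x K) ord0 i) ttm hx).
    * move=> K x hx; rewrite (VE (@ene R N)).
      exact: (glue_is_derive_left (fun x => ene (U' x K)) ttm hx).
  + apply: (@solves_at_transfer V U' t (t - tm)).
    * apply: sU'; first by rewrite subr_ge0 ltW.
      apply: lt_le_trans dt; rewrite lte_fin ltrBlDl.
      by rewrite lte_fin in tt.
    * by rewrite /V ltNge (ltW tmt).
    * by move=> K x hx; rewrite (VE (@rho R N)); exact: (glue_is_derive_right _ tmt hx).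
    * move=> K i x hx; rewrite (VE (fun w => mom w ord0 i)).
      exact: (glue_is_derive_right _ tmt hx).
    * by move=> K x hx; rewrite (VE (@ene R N)); exact: (glue_is_derive_right _ tmt hx).
  (* At the junction the rates of [U] tend to the right-hand side at [W] by continuity, and [U']
     starts from [W] with that same rate. *)
  + have t'0 : (0%:E < tmax)%E by [].
    have [hr hm hE] := solves_rhs sU' (lexx 0) t'0.
    rewrite {}ttm; apply: (@solves_at_transfer V U' tm 0).
    * exact: sU'.
    * by rewrite /V ltxx subrr.
    * move=> K x hx; rewrite (VE (@rho R N)).
      have -> : x = rhs_rho mu W K.
        by rewrite -U'0 -(is_derive_derive1 hx) -(is_derive_derive1 (hr K)).
      apply: (glue_is_derive tm0
        (g := fun x => rho (U' x K))
        (df := fun t => rhs_rho mu (U t) K)) => [y /der yI|||].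
      - by have [h _ _] := solves_rhs sU yI.1 yI.2.
      - by rewrite U'0; case: (cW K).
      - exact: tends_rhs_rho.
      - by rewrite -U'0; exact: hr.
    * move=> K i x hx; rewrite (VE (fun w => mom w ord0 i)).
      have -> : x = rhs_mom gamma alpha mu W K i.
        by rewrite -U'0 -(is_derive_derive1 hx) -(is_derive_derive1 (hm K i)).
      apply: (glue_is_derive tm0
        (g := fun x => mom (U' x K) ord0 i)
        (df := fun t => rhs_mom gamma alpha mu (U t) K i)) => [y /der yI|||].
      - by have [_ h _] := solves_rhs sU yI.1 yI.2.
      - by rewrite U'0; case: (cW K).
      - exact: tends_rhs_mom.
      - by rewrite -U'0; exact: hm.
    * move=> K x hx; rewrite (VE (@ene R N)).
      have -> : x = rhs_ene gamma alpha mu W K.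
        by rewrite -U'0 -(is_derive_derive1 hx) -(is_derive_derive1 (hE K)).
      apply: (glue_is_derive tm0
        (g := fun x => ene (U' x K))
        (df := fun t => rhs_ene gamma alpha mu (U t) K)) => [y /der yI|||].
      - by have [_ _ h] := solves_rhs sU yI.1 yI.2.
      - by rewrite U'0; case: (cW K).
      - exact: tends_rhs_ene.
      - by rewrite -U'0; exact: hE.
- move=> t t0 tt K; rewrite /V; case: ifPn => [ttm|].
    by apply: aU; rewrite ?lte_fin.
  rewrite -leNgt => tmt; apply: aU'; first by rewrite subr_ge0.
  by apply: lt_le_trans dt; rewrite lte_fin ltrBlDl; rewrite lte_fin in tt.
Qed.

End FiniteTime.

(** A finite maximal time would be exceeded by the extended solution, against maximality. *)
Lemma global_solution (hode : ode_wellposed gamma alpha mu)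
    (U0 : Qh T (cstate R N)) : (forall K, admissible (U0 K)) ->
  exists U, [/\ solves gamma alpha mu U +oo%E, admissible_on U +oo%E, U 0 = U0 &
    forall tV V, solves gamma alpha mu V tV -> admissible_on V tV -> V 0 = U0 ->
      forall t, 0 <= t -> (t%:E < tV)%E -> V t = U t].
Proof.
move=> a0; have [tmax [U [tmax0 sU aU U00 Umax]]] := hode U0 a0.
have tmaxE : tmax = +oo%E.
  case: tmax tmax0 sU aU Umax => [tm|//|//] tm0 sU aU Umax.
  have [d [V [d0 sV aV V0]]] := solution_extends tm0 sU aU hode.
  have [] := Umax _ V sV aV _; first by rewrite V0.
  by rewrite lee_fin gerDl leNgt d0.
rewrite {}tmaxE in sU aU Umax; exists U; split=> // tV V sV aV V0.
by have [] := Umax tV V sV aV V0.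
Qed.

Lemma admissible_near V t : solves gamma alpha mu V +oo%E -> 0 <= t ->
  (forall K, admissible (V t K)) -> \forall x \near t, forall K, admissible (V x K).
Proof.
move=> sV t0 aV; have [hr hm hE] := solves_derive sV t0 (ltry t).
apply: (@filter_forall _ _ (fun K x => admissible (V x K)) (nbhs t) _) => K.
have [r0 i0] := aV K; have rn := is_derive_gt0 (hr K) r0.
have di := is_derive_internal r0 (hr K) (hm K) (hE K).
exact: (filterI rn (is_derive_gt0 di i0)).
Qed.

Lemma eq_of_left_limit (f g : R -> R) (a da db : R) : 0 < a ->
  (forall x, 0 <= x < a -> f x = g x) ->
  is_derive a 1 f da -> is_derive a 1 g db -> f a = g a.
Proof.
move=> a0 fg fd gd.
have ft : tends (a^'-) f (f a).
  by apply: cvg_at_left_filter; exact: is_derive_cvg fd.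
have gt : tends (a^'-) g (g a).
  by apply: cvg_at_left_filter; exact: is_derive_cvg gd.
have t : tends (a^'-) (fun x => f x + - g x) (f a + - g a).
  by apply: tendsD => //; exact: tendsN.
apply/eqP; rewrite -subr_eq0 eq_le; apply/andP; split.
  apply: (cvgr_to_le t); apply: filterS (at_left_itv a0) => x /fg ->.
  by rewrite subrr.
apply: (cvgr_to_ge t); apply: filterS (at_left_itv a0) => x /fg ->.
by rewrite subrr.
Qed.

(* A solution that is not assumed admissible agrees with the admissible one up to
   its first exit time from the admissible set, where it is admissible by
   continuity: there is no exit. *)
Lemma solves_admissible U V : solves gamma alpha mu U +oo%E ->
  admissible_on U +oo%E ->
  (forall tV, solves gamma alpha mu V tV -> admissible_on V tV ->
    forall t, 0 <= t -> (t%:E < tV)%E -> V t = U t) ->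
  solves gamma alpha mu V +oo%E -> V 0 = U 0 -> admissible_on V +oo%E.
Proof.
move=> sU aU uniq sV V0 t1 t1_0 _.
apply: contrapT => bad1.
pose S := [set t | 0 <= t /\ ~ (forall K, admissible (V t K))].
have S1 : S t1 by [].
have S0 : S !=set0 by exists t1.
have lbS : lbound S 0 by move=> t [].
have hlbS : has_lbound S by exists 0.
have tau0 : 0 <= inf S by exact: lb_le_inf.
set tau := inf S in tau0.
have before t : 0 <= t -> t < tau -> forall K, admissible (V t K).
  move=> t0 tt; apply: contrapT => bad.
  have : tau <= t by apply: ge_inf.
  by rewrite leNgt tt.
have VU t : 0 <= t -> t < tau -> V t = U t.
  move=> t0 tt; apply: (uniq tau%:E) => //; rewrite ?lte_fin //.
  by move=> s s0 _; apply: sV; rewrite ?ltry.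
have Vtau : V tau = U tau.
  (* At time 0 there is no left limit to use; agreement comes from the common initial state. *)
  have [tau_eq|tau_gt] := eqVneq tau 0; first by rewrite tau_eq.
  have {}tau_gt : 0 < tau by rewrite lt_neqAle eq_sym tau_gt.
  have [ur um ue] := solves_derive sU tau0 (ltry tau).
  have [vr vm ve] := solves_derive sV tau0 (ltry tau).
  have VUI t : 0 <= t < tau -> V t = U t by case/andP; exact: VU.
  apply/funext => K; apply: cstate_ext => [|i|].
  - apply: (eq_of_left_limit tau_gt _ (vr K) (ur K)) => t /VUI Vt.
    by rewrite Vt.
  - apply: (eq_of_left_limit tau_gt _ (vm K i) (um K i)) => t /VUI Vt.
    by rewrite Vt.
  - apply: (eq_of_left_limit tau_gt _ (ve K) (ue K)) => t /VUI Vt.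
    by rewrite Vt.
have aV : forall K, admissible (V tau K).
  by rewrite Vtau; apply: aU => //; exact: ltry.
(* Admissibility on a whole ball makes [tau + e] a lower bound of the exit times, contradicting the
   infimum. *)
have /nbhs_ballP[e /= e0 eP] := admissible_near sV tau0 aV.
have : tau + e <= tau.
  apply: lb_le_inf => // t [t0 bad]; rewrite leNgt; apply/negP => te.
  have taut : tau <= t by apply: ge_inf.
  apply: bad; apply: eP; rewrite /ball /= distrC ger0_norm ?subr_ge0 //.
  by rewrite ltrBlDl.
by rewrite gerDl leNgt e0.
Qed.

End GlobalSolution.

Theorem theorem4p2 (R : realType) (N : nat) (T : mesh_data R N)
    (gamma alpha : R) (mu : iface T -> cstate R N -> cstate R N -> R)
    (rho0 : Qh T R) (m0 : Qh T 'rV[R]_N) (E0 : Qh T R) (rho_low : R)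
    (hN : (1 <= N <= 3)%N)
    (hT : regular_mesh T)
    (hgamma : 1 < gamma)
    (hmu : viscosity_ok mu)
    (hode : ode_wellposed gamma alpha mu)
    (hrho_low : 0 < rho_low)
    (hrho0 : forall K, rho_low <= rho0 K)
    (hE0 : forall K, 0 < E0 K - 2^-1 * (sqnorm (m0 K) / rho0 K)) :
  exists U : R -> Qh T (cstate R N),
    [/\ solves gamma alpha mu U +oo%E,
        U 0 = (fun K => (rho0 K, m0 K, E0 K)),
        (forall V : R -> Qh T (cstate R N),
           solves gamma alpha mu V +oo%E ->
           V 0 = (fun K => (rho0 K, m0 K, E0 K)) ->
           forall t : R, 0 <= t -> V t = U t),
        (forall t : R, 0 <= t -> forall K,
           0 < rho (U t K) /\
           0 < ene (U t K) - 2^-1 * (sqnorm (mom (U t K)) / rho (U t K))) &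
        (forall (chi : R -> R) (Phi : Qh T R), renormalization chi ->
           forall t : R, 0 <= t ->
           derivable (fun x : R => vol_int (fun K =>
             rho (U x K) * chi (entr gamma (U x K)) * Phi K)) t 1 /\
           derive1 (fun x : R => vol_int (fun K =>
             rho (U x K) * chi (entr gamma (U x K)) * Phi K)) t
           - entropy_flux gamma chi (U t) Phi
           = entropy_production gamma alpha mu chi (U t) Phi
             - entropy_cross_defect gamma mu chi (U t) Phi)].
Proof.
have a0 K : admissible (rho0 K, m0 K, E0 K).
  by split; [exact: lt_le_trans (hrho0 K) | exact: hE0].
have [U [sU aU U0 uniq]] := global_solution hT hgamma hmu hode a0.
exists U; split=> // [V sV V0 t t0|t t0 K|chi Phi [_ _ [dchi _ _] _] t t0].
(* The competing solution is not assumed admissible; it is first shown to be, so that uniqueness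
   among admissible solutions applies. *)
- apply: (uniq +oo%E) => //; last exact: ltry.
  apply: (solves_admissible sU aU _ sV) => [tV sV' aV'|].
    exact: (uniq tV).
  by rewrite V0 U0.
- exact: (aU t t0 (ltry t) K).
have aUt K : admissible (U t K) by exact: (aU t t0 (ltry t) K).
have [hr hm hE] := solves_derive sU t0 (ltry t).
have [_ [eC eM eE]] := sU t t0 (ltry t).
have d := entropy_balance hT hgamma dchi Phi aUt hr hm hE eC eM eE.
by split; [case: d | rewrite (is_derive_derive1 d) addrC addKr].
Qed.
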